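(* Let $\{\mathcal{P}_n\}_{n=1}^\infty$ be a sequence of pyramids converging weakly to a pyramid $\mathcal{P}$, and let $0<\delta\le+\infty$. Then $\{\mathcal{P}_n\}$ $\delta$-dissipates if and only if $\mathcal{P}$ is $\delta$-dissipated. Likewise, $\{\mathcal{P}_n\}$ weakly dissipates if and only if $\mathcal{P}$ is weakly dissipated.
   Context: An mm-space is a triple $(X,d_X,\mu_X)$ with $(X,d_X)$ a complete separable metric space and $\mu_X$ a Borel probability measure; we always assume $X=\operatorname{supp}\mu_X$. $\mathcal{X}$ is the set of mm-isomorphism classes of mm-spaces (mm-isomorphism: measure-preserving isometry between supports). $Y\prec X$ means there is a $1$-Lipschitz map $f:X\to Y$ with $f_*\mu_X=\mu_Y$. Box distance: a parameter of $X$ is a Borel map $\varphi:I=[0,1)\to X$ with $\varphi_*\mathcal{L}^1=\mu_X$. $\square(X,Y)$ is the infimum of $\varepsilon\ge0$ such that there are parameters $\varphi$ of $X$, $\psi$ of $Y$ and a Borel set $I_0\subset I$ with $\mathcal{L}^1(I_0)\ge1-\varepsilon$ and $|d_X(\varphi(s),\varphi(t))-d_Y(\psi(s),\psi(t))|\le\varepsilon$ for all $s,t\in I_0$. It is a metric on $\mathcal{X}$. A pyramid is a nonempty $\square$-closed subset $\mathcal{P}\subset\mathcal{X}$ such that (i) $X\in\mathcal{P}$ and $Y\prec X$ imply $Y\in\mathcal{P}$; (ii) for any $X,X'\in\mathcal{P}$ there is $Y\in\mathcal{P}$ with $X\prec Y$, $X'\prec Y$. Weak convergence $\mathcal{P}_n\to\mathcal{P}$: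 $\lim_{n}\square(X,\mathcal{P}_n)=0$ for every $X\in\mathcal{P}$, and $\liminf_n\square(X,\mathcal{P}_n)>0$ for every $X\in\mathcal{X}\setminus\mathcal{P}$, where $\square(X,\mathcal{P}_n)=\inf_{Y\in\mathcal{P}_n}\square(X,Y)$. Separation distance: for an mm-space $X$ and $\kappa_0,\dots,\kappa_N>0$, $N\ge1$, $\operatorname{Sep}(X;\kappa_0,\dots,\kappa_N)$ is the supremum of $\min_{i\ne j}d_X(A_i,A_j)$ over Borel sets $A_0,\dots,A_N\subset X$ with $\mu_X(A_i)\ge\kappa_i$ for all $i$, where $d_X(A,B)=\inf_{x\in A,y\in B}d_X(x,y)$; it is $0$ if no such sets exist. For a pyramid, $\operatorname{Sep}(\mathcal{P};\kappa_0,\dots,\kappa_N)=\lim_{\eta\to0+}\sup_{X\in\mathcal{P}}\operatorname{Sep}(X;\kappa_0-\eta,\dots,\kappa_N-\eta)\in[0,+\infty]$. In the following, $N\ge1$ and $\kappa_0,\dots,\kappa_N>0$ range over all choices with $\sum_{i=0}^N\kappa_i<1$. $\{\mathcal{P}_n\}$ $\delta$-dissipates if $\liminf_n\operatorname{Sep}(\mathcal{P}_n;\kappa_0,\dots,\kappa_N)\ge\delta$ for all such choices; it weakly dissipates if $\liminf_n\operatorname{Sep}(\mathcal{P}_n;\kappa_0,\dots,\kappa_N)>0$ for all such choices. A pyramid $\mathcal{P}$ is $\delta$-dissipated if it contains all mm-spaces with diameter $\le\delta$ (for $\delta=+\infty$: $\mathcal{P}=\mathcal{X}$); it is weakly dissipated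 if $\operatorname{Sep}(\mathcal{P};\kappa_0,\dots,\kappa_N)>0$ for all such choices. *)

(* Defs.v *)
From HB Require Import structures.
From mathcomp Require Import all_boot all_order all_algebra.
From mathcomp Require Import all_classical all_reals all_analysis.

Set Implicit Arguments.
Unset Strict Implicit.
Unset Printing Implicit Defensive.

Import Order.TTheory GRing.Theory Num.Theory.

Local Open Scope classical_set_scope.
Local Open Scope ring_scope.
Local Open Scope ereal_scope.

#[short(type="completeMetricType")]
HB.structure Definition CompleteMetric (R : numDomainType) :=
  {T of Metric R T & Complete T}.

Definition borelType (T : ptopologicalType) := g_sigma_algebraType (@open T).

Section mm_spaces.
Context {R : realType}.

Definition separable_space (T : topologicalType) :=
  exists2 D : set T, countable D & dense D.

Definition measure_support (T : ptopologicalType)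
    (mu : {measure set (borelType T) -> \bar R}) : set T :=
  [set x | forall U : set T, open U -> U x -> 0 < mu U].

Record mmSpace := MMSpace {
  mm_carrier :> completeMetricType R;
  mm_separable : separable_space mm_carrier;
  mm_measure : probability (borelType mm_carrier) R;
  mm_support : measure_support mm_measure = setT }.

Definition measure_preserving (X Y : mmSpace) (f : X -> Y) :=
  forall B : set (borelType Y), measurable B ->
    mm_measure X (f @^-1` B) = mm_measure Y B.

(* The elements of the set of mm-isomorphism classes are represented by
   mm-spaces; [pyramid_mm_iso] below shows that pyramids are saturated. *)
Definition mm_iso (X Y : mmSpace) := exists f : X -> Y,
  [/\ bijective f, (forall x y, mdist (f x) (f y) = mdist x y) &
      measure_preserving f].

Definition dominated (Y X : mmSpace) := exists f : X -> Y,
  (forall x y, (mdist (f x) (f y) <= mdist x y)%R) /\ measure_preserving f.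

(* A map on [0, 1) is given as a map on the real line of which only the
   restriction to [0, 1) matters. *)
Definition is_parameter (X : mmSpace) (phi : R -> X) :=
  measurable_fun (`[0%R, 1%R[ : set R)
    (phi : measurableTypeR R -> borelType X) /\
  forall B : set (borelType X), measurable B ->
    lebesgue_measure (`[0%R, 1%R[ `&` phi @^-1` B) = mm_measure X B.

Definition box (X Y : mmSpace) : \bar R :=
  ereal_inf [set e%:E | e in [set e : R | (0 <= e)%R /\
    exists (phi : R -> X) (psi : R -> Y) (I0 : set R),
    [/\ is_parameter phi, is_parameter psi,
        measurable (I0 : set (measurableTypeR R)) /\ I0 `<=` `[0%R, 1%R[,
        (1 - e)%:E <= lebesgue_measure I0 &
        forall s t, I0 s -> I0 t ->
          (`|mdist (phi s) (phi t) - mdist (psi s) (psi t)| <= e)%R]]].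

Definition box_to (X : mmSpace) (P : set mmSpace) : \bar R :=
  ereal_inf [set box X Y | Y in P].

Definition box_closed (P : set mmSpace) := forall X : mmSpace,
  (forall e : R, (0 < e)%R -> exists2 Y, P Y & box X Y < e%:E) -> P X.

Record pyramid (P : set mmSpace) : Prop := Pyramid {
  pyramid_nonempty : P !=set0;
  pyramid_closed : box_closed P;
  pyramid_lower : forall X Y, P X -> dominated Y X -> P Y;
  pyramid_directed : forall X X', P X -> P X' ->
    exists Y, [/\ P Y, dominated X Y & dominated X' Y] }.

Definition weakly_converges (Pn : nat -> set mmSpace) (P : set mmSpace) :=
  (forall X, P X -> (fun n => box_to X (Pn n)) @ \oo --> 0) /\
  (forall X, ~ P X -> 0 < limn_einf (fun n => box_to X (Pn n))).

Definition set_dist (X : mmSpace) (A B : set X) : \bar R :=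
  ereal_inf [set (mdist x y)%:E | x in A & y in B].

(* Set distances are nonnegative, so the adjoined 0 only matters when there is
   no admissible family. *)
Definition Sep (X : mmSpace) (N : nat) (kappa : 'I_N.+1 -> R) : \bar R :=
  ereal_sup (0 |`
    [set \big[mine/+oo]_(p : 'I_N.+1 * 'I_N.+1 | p.1 != p.2)
           set_dist (A p.1) (A p.2)
    | A in [set A : 'I_N.+1 -> set X | forall i,
        measurable (A i : set (borelType X)) /\
        (kappa i)%:E <= mm_measure X (A i)]]).

Definition pyramid_Sep (P : set mmSpace) (N : nat) (kappa : 'I_N.+1 -> R) :
    \bar R :=
  lim ((fun eta : R =>
          ereal_sup [set Sep X (fun i => (kappa i - eta)%R) | X in P])
       @ (0%R : R)^'+).

Definition admissible (N : nat) (kappa : 'I_N.+1 -> R) :=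
  [/\ (1 <= N)%N, (forall i, (0 < kappa i)%R) & (\sum_i kappa i < 1)%R].

Definition dissipates (delta : \bar R) (Pn : nat -> set mmSpace) :=
  forall (N : nat) (kappa : 'I_N.+1 -> R), admissible kappa ->
    delta <= limn_einf (fun n => pyramid_Sep (Pn n) kappa).

Definition weakly_dissipates (Pn : nat -> set mmSpace) :=
  forall (N : nat) (kappa : 'I_N.+1 -> R), admissible kappa ->
    0 < limn_einf (fun n => pyramid_Sep (Pn n) kappa).

Definition diameter (X : mmSpace) : \bar R :=
  ereal_sup [set (mdist x y)%:E | x in [set: X] & y in [set: X]].

(* For delta = +oo the diameter bound is vacuous, so P is everything. *)
Definition dissipated (delta : \bar R) (P : set mmSpace) :=
  forall X : mmSpace, diameter X <= delta -> P X.

Definition weakly_dissipated (P : set mmSpace) :=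
  forall (N : nat) (kappa : 'I_N.+1 -> R), admissible kappa ->
    0 < pyramid_Sep P kappa.

Lemma pyramid_mm_iso (P : set mmSpace) (X Y : mmSpace) :
  pyramid P -> mm_iso X Y -> P X -> P Y.
Proof.
move=> pP [f [_ fd fm]] PX; apply: (pyramid_lower pP PX).
by exists f; split=> // x y; rewrite fd.
Qed.

End mm_spaces.

Arguments mmSpace R : clear implicits.

(* Main.v *)
(* Sets that are far apart in X are carried over to Y when the box distance of X and
   Y is small, so lower bounds on separation pass from P to the P_n: for weakly
   dissipated P directly, for delta-dissipated P through the simplices of side delta.

   Conversely, a D-separated family B_0, ..., B_M in Y whose members weigh about as
   much as the cells around points x_0, ..., x_M of X yields, by McShane extension of
   min(d(x_i, x_j), D), a 1-Lipschitz map from Y to a sup-normed space that sends B_i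
   to a copy of x_i. Its image is dominated by Y and box-close to X once parameters
   of X and Y are aligned cell by cell; with diam X <= delta and D close to delta this
   puts X in P. If only weak dissipation is known, the family is sent to i c / (N + 1)
   on the interval [0, c]; the quantile functions of the image measures have a cluster
   point by Tychonoff's theorem, its law is a space of P, and it inherits the
   separation.

   Parameters of a Polish space are obtained by coding its points by reals and
   transporting the quantile function of the code. *)
Require Import Defs.
From HB Require Import structures.
From mathcomp Require Import all_boot all_order all_algebra.
From mathcomp Require Import all_classical all_reals all_analysis.
From mathcomp Require Import measurable_realfun lra.
Set Implicit Arguments.
Unset Strict Implicit.
Unset Printing Implicit Defensive.
Import Order.TTheory GRing.Theory Num.Theory.
Import numFieldNormedType.Exports numFieldTopology.Exports.
Local Open Scope classical_set_scope.
Local Open Scope ring_scope.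

(** Weak dissipation bounds the separation below, but not uniformly in the masses, so a prescribed
    space cannot be rebuilt from it. Instead each choice of masses gets its own limit space, and
    mapping into one fixed interval supplies the compactness. Under delta-dissipation the bound is
    uniform, so any finite pattern of distances up to D can be copied. The target is sup-normed
    because McShane extension works coordinate by coordinate. In both cases membership in P comes
    from the second clause of weak convergence: approximants in the P_n for arbitrarily late n
    suffice, so a cluster point is as good as a limit. Two technical obstacles shape the rest. The
    box distance is bounded above only by exhibiting parameters of both spaces, whence the work on
    quantile functions and codes; and the image of a Borel set under a Borel map need not be Borel,
    so transported families are replaced by their closures. *)

Lemma small_inv {R : realType} (e : R) : 0 < e -> exists k : nat, k.+1%:R^-1 < e.
Proof.
move=> e0; exists (Num.bound e^-1).
by rewrite invf_plt ?posrE// (lt_le_trans (archi_boundP _)) ?ler_nat// invr_ge0 ltW.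
Qed.

Lemma ball_metric_open {R : realType} (X : metricType R) (x : X) (e : R) : open (ball x e).
Proof.
rewrite openE => y; rewrite ballEmdist/= => xy; apply/nbhs_ballP.
exists (e - mdist x y) => [|z]; first by rewrite /= subr_gt0.
rewrite !ballEmdist/= => yz; rewrite (le_lt_trans (metric_triangle x y z))//.
by rewrite -ltrBrDl.
Qed.

(** This is what allows images of Borel sets, possibly not measurable, to be replaced by closed sets
    without loss of separation. *)
Lemma closure_mdist_ge {R : realType} (X : metricType R) (A B : set X) (D : R) :
  (forall x y, A x -> B y -> D <= mdist x y) ->
  forall x y, closure A x -> closure B y -> D <= mdist x y.
Proof.
move=> AB x y Ax By; apply/ler_addgt0Pr => h h0.
have h20 : 0 < h / 2 by rewrite divr_gt0.
have [x' [Ax' xx']] : (A `&` ball x (h / 2)) !=set0 by apply: Ax; exact: nbhsx_ballx.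
have [y' [By' yy']] : (B `&` ball y (h / 2)) !=set0 by apply: By; exact: nbhsx_ballx.
rewrite !ballEmdist/= in xx' yy'.
have := AB _ _ Ax' By'; have := metric_triangle x' x y'; have := metric_triangle x y y'.
rewrite (metric_sym x' x); lra.
Qed.

(** * Borel sets, image measures and real-valued probabilities *)

Section borel.

Lemma open_borel (X : ptopologicalType) (U : set X) :
  open U -> measurable (U : set (borelType X)).
Proof. by move=> oU; apply: sub_gen_smallest. Qed.

Lemma closed_borel (X : ptopologicalType) (F : set X) :
  closed F -> measurable (F : set (borelType X)).
Proof.
by move=> cF; have := measurableC (open_borel (closed_openC cF)); rewrite setCK.
Qed.

Lemma borel_measurable d (T : measurableType d) (X : ptopologicalType) (f : T -> X) :
  (forall U, open U -> measurable (f @^-1` U)) ->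
  measurable_fun setT (f : T -> borelType X).
Proof.
move=> fo; apply: (@measurability _ _ T (borelType X) setT f (@open X)) => // _ [U oU <-]; rewrite setTI.
exact: fo.
Qed.

Lemma continuous_borel (X Y : ptopologicalType) (f : X -> Y) :
  continuous f -> measurable_fun setT (f : borelType X -> borelType Y).
Proof.
move=> cf; apply: borel_measurable => U oU; apply: open_borel.
by move/continuousP : cf; exact.
Qed.

Lemma pushforward_probability {R : realType} d d' (T : measurableType d)
  (T' : measurableType d') (P : probability T R) (f : T -> T') :
  measurable_fun setT f ->
  exists Q : probability T' R, forall B, measurable B -> Q B = P (f @^-1` B).
Proof.
move=> mf; pose F : {mfun T >-> T'} := HB.pack f (isMeasurableFun.Build _ _ _ _ f mf).
by exists (distribution P F).
Qed.

Lemma measureI_conull {R : realType} d (T : measurableType d)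
  (mu : {measure set T -> \bar R}) (A S : set T) :
  measurable A -> measurable S -> mu (~` S) = 0%E -> mu (A `&` S) = mu A.
Proof.
move=> mA mS S0; have AS0 : mu (A `\` S) = 0%E.
  apply/eqP; rewrite eq_le measure_ge0 andbT -S0 le_measure// ?inE//.
  - exact: measurableD.
  - exact: measurableC.
transitivity (mu (A `\` S) + mu (A `&` S))%E; first by rewrite AS0 add0e.
exact/esym/measureDI.
Qed.

End borel.

Section pr.
Context {R : realType} d (T : measurableType d) (P : probability T R).
Implicit Types A B : set T.

Definition pr A : R := fine (P A).

Lemma prE A : measurable A -> P A = (pr A)%:E.
Proof. by move=> mA; rewrite /pr fineK// fin_num_measure. Qed.

Lemma pr_le A B : measurable A -> measurable B -> A `<=` B -> pr A <= pr B.
Proof. by move=> mA mB AB; rewrite -lee_fin -!prE// le_measure// inE. Qed.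

Lemma pr_ge0 A : 0 <= pr A.
Proof. by rewrite fine_ge0. Qed.

Lemma prT : pr setT = 1.
Proof. by rewrite /pr probability_setT. Qed.

Lemma prC A : measurable A -> pr (~` A) = 1 - pr A.
Proof. by move=> mA; rewrite /pr probability_setC// prE. Qed.

Lemma pr_le1 A : measurable A -> pr A <= 1.
Proof. by move=> mA; have := pr_ge0 (~` A); rewrite prC// subr_ge0. Qed.

Lemma prDI A B : measurable A -> measurable B -> pr A = pr (A `\` B) + pr (A `&` B).
Proof.
move=> mA mB; have mD := measurableD mA mB; have mI := measurableI _ _ mA mB.
by apply: EFin_inj; rewrite EFinD -!prE//; exact: measureDI.
Qed.

Lemma prU_le A B : measurable A -> measurable B -> pr (A `|` B) <= pr A + pr B.
Proof.
move=> mA mB; have mU := measurableU _ _ mA mB.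
by rewrite -lee_fin EFinD -!prE//; exact: measureU2.
Qed.

Lemma prI_ge A B : measurable A -> measurable B -> pr A + pr B - 1 <= pr (A `&` B).
Proof.
move=> mA mB; have mI := measurableI _ _ mA mB.
have mA' := measurableC mA; have mB' := measurableC mB.
have := prU_le mA' mB'; rewrite -setCI !prC//; lra.
Qed.

Lemma pr_bigcap_ge n (A : nat -> set T) (e : R) : 0 <= e ->
  (forall k, measurable (A k)) -> (forall k, 1 - e <= pr (A k)) ->
  1 - n%:R * e <= pr (\bigcap_(k in `I_n) A k).
Proof.
move=> e0 mA Ae; elim: n => [|n IHn].
  by rewrite mul0r subr0 II0 bigcap_set0 prT.
rewrite IIS bigcap_setU bigcap_set1.
have mI : measurable (\bigcap_(k in `I_n) A k) by apply: bigcap_measurableType.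
have := prI_ge mI (mA n); have := Ae n; rewrite mulrS; lra.
Qed.

End pr.

Section extended_limits.
Context {R : realType}.
Local Open Scope ereal_scope.

Lemma lt_limn_einf (u : (\bar R)^nat) (a : \bar R) :
  a < limn_einf u -> exists n0, forall n, (n0 <= n)%N -> a < u n.
Proof.
rewrite limn_einf_lim (cvg_lim _ (@cvg_einfs_sup _ u))// => /ereal_sup_gt[_ [n0 _ <-]] an0.
exists n0 => n n0n; apply: (lt_le_trans an0).
by apply: ereal_inf_lbound; exists n.
Qed.

Lemma limn_einf_ge (u : (\bar R)^nat) (a : \bar R) n0 :
  (forall n, (n0 <= n)%N -> a <= u n) -> a <= limn_einf u.
Proof.
move=> au; rewrite limn_einf_lim (cvg_lim _ (@cvg_einfs_sup _ u))//.
apply: le_trans (ereal_sup_ubound _); last by exists n0.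
by apply: le_ereal_inf_tmp => _ [n /= n0n <-]; exact: au.
Qed.

(** Reduces inequalities between possibly infinite separations to real thresholds, the infinite case
    of [delta] included. *)
Lemma lee_real_lt (x y : \bar R) :
  (forall c : R, c%:E < x -> c%:E <= y) -> x <= y.
Proof.
move=> xy; rewrite leNgt; apply/negP => yx.
case: x y xy yx => [x| |] [y| |]//= xy yx.
- rewrite lte_fin in yx; have /xy : ((x + y) / 2)%:E < x%:E by rewrite lte_fin; lra.
  by rewrite lee_fin; lra.
- have /xy : (x - 1)%:E < x%:E by rewrite lte_fin; lra.
  by [].
- have := xy (y+1)%R (ltry _); rewrite lee_fin; lra.
- by have := xy 0%R (ltry _).
Qed.

End extended_limits.

(** * Separation *)

Section sep.
Context {R : realType}.
Local Open Scope ereal_scope.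
Implicit Types (X Y : mmSpace R) (P : set (mmSpace R)).

(** A witness form of [D <= Sep X kappa]: with pointwise bounds in place of a supremum of infima,
    families can be transported and closed up directly. *)
Definition sep_family X N (kappa : 'I_N.+1 -> R) (D : R) :=
  exists A : 'I_N.+1 -> set X, [/\
    forall i, measurable (A i : set (borelType X)),
    forall i, (kappa i)%:E <= mm_measure X (A i) &
    forall i j x y, i != j -> A i x -> A j y -> (D <= mdist x y)%R].

Lemma lt_Sep_family X N (kappa : 'I_N.+1 -> R) (D : R) :
  (0 <= D)%R -> D%:E < Sep X kappa -> sep_family X kappa D.
Proof.
(* The value 0 adjoined in [Sep] has no family behind it; it is excluded by [0 <= D] and the strict
   inequality. *)
move=> D0 /ereal_sup_gt[x [->|[A Ak <-] DA]]; first by rewrite lte_fin ltNge D0.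
exists A; split; [by move=> i; case: (Ak i)..|].
move=> i j a b ij Aa Ab; rewrite -lee_fin; apply: (le_trans (ltW DA)).
rewrite (bigD1 (i, j))//= ge_min; apply/orP; left.
by apply: ereal_inf_lbound; exists a => //; exists b.
Qed.

Lemma sep_family_le_Sep X N (kappa : 'I_N.+1 -> R) (D : R) :
  sep_family X kappa D -> D%:E <= Sep X kappa.
Proof.
move=> [A [mA Ak AD]].
have : D%:E <= \big[mine/+oo]_(p : 'I_N.+1 * 'I_N.+1 | p.1 != p.2)
           set_dist (A p.1) (A p.2).
  elim/big_ind: _ => [|x y Dx Dy|[i j]/= ij]; rewrite ?leey//.
    by rewrite le_min Dx.
  by apply: le_ereal_inf_tmp => _ [x Ax [y Ay <-]]; rewrite lee_fin (AD i j).
move/le_trans; apply; apply: ereal_sup_ubound; right.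
by exists A => // i; split.
Qed.

Lemma sep_family_le X N (k k' : 'I_N.+1 -> R) (D D' : R) :
  (forall i, k' i <= k i)%R -> (D' <= D)%R ->
  sep_family X k D -> sep_family X k' D'.
Proof.
move=> kk DD [A [mA Ak AD]]; exists A; split => //.
  by move=> i; apply: le_trans (Ak i); rewrite lee_fin.
by move=> i j x y ij Ax Ay; apply: le_trans (AD _ _ _ _ ij Ax Ay).
Qed.

Lemma Sep_le X N (k k' : 'I_N.+1 -> R) :
  (forall i, k' i <= k i)%R -> Sep X k <= Sep X k'.
Proof.
move=> kk; apply: lee_real_lt => c ck.
have [c0|c0] := ltP c 0%R.
  by apply: (@le_trans _ _ 0); [rewrite lee_fin ltW|apply: ereal_sup_ubound; left].
by apply: sep_family_le_Sep; apply: sep_family_le (lt_Sep_family c0 ck).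
Qed.

(** A larger [eta] relaxes the mass constraints, so the suprema are nondecreasing in [eta] and their
    right limit at 0 is an infimum. *)
Lemma pyramid_SepE P N (kappa : 'I_N.+1 -> R) :
  pyramid_Sep P kappa = ereal_inf [set
    ereal_sup [set Sep X (fun i => (kappa i - eta)%R) | X in P] | eta in
    [set eta : R | (0 < eta)%R]].
Proof.
rewrite /pyramid_Sep.
rewrite (cvg_lim _ (@nondecreasing_at_right_cvge _ _ _ (BInfty _ false) _ _))//.
  congr ereal_inf; apply/seteqP; split => _ [e e0 <-]; exists e => //.
    by move: e0; rewrite /= in_itv/= andbT.
  by rewrite /= in_itv/= andbT.
move=> e e' _ _ ee; apply: ge_ereal_sup => _ [X PX <-].
apply: le_trans (ereal_sup_ubound _); last by exists X.
by apply: Sep_le => i; rewrite lerD2l lerN2.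
Qed.

Lemma pyramid_Sep_ge P N (kappa : 'I_N.+1 -> R) (D : R) :
  (forall eta, (0 < eta)%R -> exists2 X, P X &
     sep_family X (fun i => (kappa i - eta)%R) D) ->
  D%:E <= pyramid_Sep P kappa.
Proof.
move=> PD; rewrite pyramid_SepE; apply: le_ereal_inf_tmp => _ [e /PD[X PX XD] <-].
by apply: le_trans (sep_family_le_Sep XD) (ereal_sup_ubound _); exists X.
Qed.

Lemma lt_pyramid_Sep P N (kappa : 'I_N.+1 -> R) (D : R) :
  (0 <= D)%R -> D%:E < pyramid_Sep P kappa ->
  forall eta, (0 < eta)%R -> exists2 X, P X &
     sep_family X (fun i => (kappa i - eta)%R) D.
Proof.
move=> D0; rewrite pyramid_SepE => DP e e0.
have /ereal_sup_gt[_ [X PX <-]] :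
    D%:E < ereal_sup [set Sep X (fun i => (kappa i - e)%R) | X in P].
  by apply: lt_le_trans DP _; apply: ereal_inf_lbound; exists e.
by move=> DX; exists X => //; exact: lt_Sep_family.
Qed.

End sep.

Lemma rat_rv_near {R : realType} (n : nat) (v : 'rV[R]_n.+1) (e : R) : 0 < e ->
  exists q : 'rV[rat]_n.+1, `|v - map_mx ratr q| < e.
Proof.
move=> e0.
have qP i : exists q : rat, `|v ord0 i - ratr q| < e.
  have [q] := @rat_in_itvoo R (v ord0 i) (v ord0 i + e) ltac:(lra).
  rewrite in_itv/= => /andP[vq qv]; exists q.
  by rewrite ltr_distlC; lra.
exists (\row_i projT1 (cid (qP i))).
have : ball v e (map_mx ratr (\row_i projT1 (cid (qP i)))).
  split=> // i j; rewrite !mxE ord1; case: cid => q/= vq.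
  by rewrite -ball_normE.
by rewrite -ball_normE.
Qed.

(** * Spaces supported in finite-dimensional sup-normed spaces *)

(* Row vectors live in a universe that is too large for the carrier of an
   [mmSpace]: they are encoded by sequences that vanish after rank [n]. *)
Definition subrv {R : realType} n (S : set 'rV[R]_n.+1) of S !=set0 & closed S : Type :=
  {f : nat -> R | (forall m, (n < m)%N -> f m = 0) /\ S (\row_i f i)}.

Section normed_subspace.
Context {R : realType} (n : nat).
Local Notation V := 'rV[R]_n.+1.
Variables (S : set V) (S0 : S !=set0) (cS : closed S).

Local Notation subrv := (subrv S0 cS).

Definition rv_val (z : subrv) : V := \row_i (sval z i).

Lemma rv_valP z : S (rv_val z).
Proof. by case: z => f []. Qed.

Lemma rv_val_inj : injective rv_val.
Proof.
move=> [f [f0 Sf]] [g [g0 Sg]]; rewrite /rv_val/= => /matrixP fg.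
apply: eq_exist; apply/funext => m; have [nm|mn] := ltnP n m.
  by rewrite f0 ?g0.
by have := fg ord0 (Ordinal (mn : (m < n.+1)%N)); rewrite !mxE.
Qed.

Definition rv_fun (v : V) (m : nat) : R :=
  if (m < n.+1)%N then v ord0 (inord m) else 0.

Lemma rv_funK v : \row_i rv_fun v i = v.
Proof.
by apply/rowP => i; rewrite mxE/= /rv_fun ltn_ord inord_val.
Qed.

Lemma rv_sub_subproof v : S v ->
  (forall m, (n < m)%N -> rv_fun v m = 0) /\ S (\row_i rv_fun v i).
Proof.
move=> Sv; rewrite rv_funK; split=> // m nm.
by rewrite /rv_fun ltnS leqNgt nm.
Qed.

Definition rv_sub v (Sv : S v) : subrv := exist _ (rv_fun v) (rv_sub_subproof Sv).

Lemma rv_subK v (Sv : S v) : rv_val (rv_sub Sv) = v.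
Proof. by rewrite /rv_val/= rv_funK. Qed.

(** Off [S] the value is a fixed point of [S]. In the application [S] is the support of a measure,
    so this choice only concerns a null set. *)
Definition rv_proj (v : V) : subrv :=
  if pselect (S v) is left Sv then rv_sub Sv else rv_sub (projT2 (cid S0)).

Lemma rv_projK v : S v -> rv_val (rv_proj v) = v.
Proof. by rewrite /rv_proj; case: pselect => // Sv _; rewrite rv_subK. Qed.

HB.instance Definition _ := gen_eqMixin subrv.
HB.instance Definition _ := gen_choiceMixin subrv.

Let dist (z w : subrv) : R := `|rv_val z - rv_val w|.
Let distxx z : dist z z = 0. Proof. by rewrite /dist subrr normr0. Qed.
Let dist_pos z w : dist z w = 0 -> z = w.
Proof. by move/normr0_eq0/eqP; rewrite subr_eq0 => /eqP/rv_val_inj. Qed.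
Let dist_sym z w : dist z w = dist w z. Proof. by rewrite /dist distrC. Qed.
Let dist_tri w z z' : dist z z' <= dist z w + dist w z'.
Proof. exact: ler_distD. Qed.

HB.instance Definition _ := @isMetric.Build R subrv dist distxx dist_pos dist_sym dist_tri.
HB.instance Definition _ := isPointed.Build subrv (rv_proj point).

Lemma rv_mdist (z w : subrv) : mdist z w = `|rv_val z - rv_val w|.
Proof. by []. Qed.

Lemma rv_ball (z : subrv) e : ball z e = [set w | ball (rv_val z) e (rv_val w)].
Proof. by rewrite ballEmdist -ball_normE. Qed.

Let subrv_complete (F : set_system subrv) : ProperFilter F -> cauchy F -> cvg F.
Proof.
move=> FF Fc.
have rFc : cauchy (rv_val @ F).
  apply: cauchy_exP => e e0.
  have [z Fz] := (@cauchyP _ _ F _).1 Fc _ e0.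
  by exists (rv_val z); rewrite rv_ball in Fz.
have /cvg_ex[l Fl] : cvg (rv_val @ F) by exact: cauchy_cvg.
have Sl : S l by apply: (@closed_cvg _ _ F _ rv_val S) => //; apply: nearW; exact: rv_valP.
apply/cvg_ex; exists (rv_proj l); apply/cvg_ballP => e e0.
near=> w; rewrite rv_ball/= rv_projK//.
by near: w; move/cvg_ballP : Fl; exact.
Unshelve. all: by end_near. Qed.

HB.instance Definition _ := Uniform_isComplete.Build subrv subrv_complete.

(** Rational vectors need not lie in [S]: for every rational vector and every radius [1/(k+1)], a
    point of [S] within that radius is picked whenever there is one. *)
Lemma subrv_separable : separable_space subrv.
Proof.
pose near_pt (p : 'rV[rat]_n.+1 * nat) (z : subrv) :=
  `|rv_val z - map_mx ratr p.1| < p.2.+1%:R^-1 :> R.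
pose pt p : subrv := xget point (near_pt p).
exists (range pt); first exact: card_le_trans (card_image_le _ _) (countableP _).
move=> O [z Oz] Oopen.
have /nbhs_ballP[e/= e0 eO] := open_nbhs_nbhs (conj Oopen Oz).
have [k ke] := small_inv (divr_gt0 e0 (ltr0n _ 2)).
have k0 : (0 : R) < k.+1%:R^-1 by rewrite invr_gt0.
have [q zq] := rat_rv_near (rv_val z) k0.
exists (pt (q, k)); split; last by exists (q, k).
apply: eO; rewrite ballEmdist /= rv_mdist.
have : near_pt (q, k) (pt (q, k)) by apply: (@xgetPex _ point (near_pt (q, k))); exists z.
rewrite /near_pt/= => pq.
have := ler_distD (map_mx ratr q) (rv_val z) (rv_val (pt (q, k))).
rewrite (distrC (map_mx ratr q)) => /le_lt_trans; apply.
by rewrite (splitr e) ltrD// (lt_trans _ ke).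
Qed.

Lemma rv_proj_measurable :
  measurable_fun setT (rv_proj : borelType V -> borelType subrv).
Proof.
apply: borel_measurable => U oU.
(* Open sets of the subspace are traces on [S] of open sets [W] of the ambient space; off [S] the
   map is constant. *)
pose W : set V := \bigcup_(p in [set p : subrv * R | 0 < p.2 /\ ball p.1 p.2 `<=` U])
   ball (rv_val p.1) p.2.
have oW : open W by apply: bigcup_open => p [p0 _]; exact: ball_open.
have -> : rv_proj @^-1` U = (S `&` W) `|` (~` S `&` [set _ | U (rv_sub (projT2 (cid S0)))]).
  apply/seteqP; split => v /=.
    have [Sv Uv|Sv] := pselect (S v); last by rewrite /rv_proj; case: pselect => // _ Up; right.
    left; split=> //.
    have /nbhs_ballP[e/= e0 eU] := open_nbhs_nbhs (conj oU Uv).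
    by exists (rv_proj v, e); rewrite ?rv_projK//=; exact: ballxx.
  case=> [[Sv [[z e]/= [e0 eU] zv]]|[Sv Up]].
    by apply: eU; rewrite rv_ball/= rv_projK.
  by rewrite /rv_proj; case: pselect.
have mS : measurable (S : set (borelType V)).
  exact: closed_borel.
apply: measurableU; apply: measurableI => //.
- exact: open_borel.
- exact: measurableC.
- have [Up|Up] := pselect (U (rv_sub (projT2 (cid S0)))).
    by rewrite (_ : [set _ | _] = setT)//; apply/seteqP; split.
  by rewrite (_ : [set _ | _] = set0)//; apply/seteqP; split.
Qed.

End normed_subspace.

Section support.
Context {R : realType} (n : nat).
Local Notation V := 'rV[R]_n.+1.
Variable mu : probability (borelType V) R.
Local Open Scope ereal_scope.

Lemma measure_support_closed : closed (measure_support mu).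
Proof.
suff : open (~` measure_support mu) by move=> /open_closedC; rewrite setCK.
have openP (A : set V) : (forall x, A x -> nbhs x A) -> open A by rewrite openE.
apply: openP => x /existsNP[U /not_implyP[oU /not_implyP[Ux U0]]].
apply: filterS (open_nbhs_nbhs (conj oU Ux)).
by move=> y Uy /(_ _ oU Uy).
Qed.

(** Second countability: countably many null balls, with rational centres and radii [1/(k+1)], cover
    the complement of the support. *)
Lemma measure_supportC0 : mu (~` measure_support mu) = 0.
Proof.
have mSC : measurable (~` measure_support mu : set (borelType V)).
  exact: (open_borel (closed_openC measure_support_closed)).
pose F k : set (borelType V) := if @unpickle ('rV[rat]_n.+1 * nat)%type k is Some p then
  (if `[< mu (ball (map_mx ratr p.1 : V) p.2.+1%:R^-1) = 0 >] then
     ball (map_mx ratr p.1 : V) p.2.+1%:R^-1 else set0) else set0.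
have F0 k : mu (F k) = 0 /\ measurable (F k).
  rewrite /F; case: unpickle => [p|]; last by rewrite measure0.
  case: asboolP => p0; last by rewrite measure0.
  by split=> //; apply: open_borel; exact: ball_open.
apply/negligibleP => //; apply: (@negligibleS _ _ _ _ (\bigcup_k F k)); last first.
  by apply: negligible_bigcup => k; have [F0k mFk] := F0 k; exact/negligibleP.
move=> x /existsNP[U /not_implyP[oU /not_implyP[Ux /negP U0]]].
have {}U0 : mu U = 0 by apply/eqP; rewrite eq_le measure_ge0 andbT leNgt.
have /nbhs_ballP[e/= e0 eU] := open_nbhs_nbhs (conj oU Ux).
have [k ke] := small_inv (divr_gt0 e0 (ltr0n _ 2)).
have k0 : (0 < k.+1%:R^-1 :> R)%R by rewrite invr_gt0.
have [q xq] := rat_rv_near x k0.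
have qU : ball (map_mx ratr q : V) k.+1%:R^-1 `<=` U.
  move=> y; rewrite -ball_normE/= => qy; apply: eU; rewrite -ball_normE/=.
  rewrite (le_lt_trans (ler_distD (map_mx ratr q) _ _))// (splitr e) ltrD//.
  - exact: lt_trans ke.
  - exact: lt_trans ke.
exists (pickle (q, k)) => //; rewrite /F pickleK; case: asboolP => [_|[]].
  by rewrite -ball_normE/= distrC.
apply/eqP; rewrite eq_le measure_ge0 andbT -U0 le_measure ?inE//.
  by apply: open_borel; exact: ball_open.
exact: open_borel.
Qed.

Lemma measure_support1 : mu (measure_support mu) = 1.
Proof.
have mS : measurable (measure_support mu : set (borelType V)).
  exact: (closed_borel measure_support_closed).
by have := probability_setC mu (measurableC mS); rewrite setCK measure_supportC0 sube0.
Qed.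

Lemma measure_support_neq0 : measure_support mu !=set0.
Proof.
apply/set0P/eqP => S0; have := measure_support1; rewrite S0 measure0.
by move/eqP; rewrite lt_eqF.
Qed.

(** Turns any law on [V] into an mm-space, for which full support is required. [i] is the isometric
    inclusion and [r] a retraction defined on all of [V], so that maps into [V] become maps into
    [Z]. *)
Lemma support_space : exists (Z : mmSpace R) (i : Z -> V) (r : V -> Z), [/\
   forall z w, mdist z w = `|i z - i w|%R,
   measurable_fun setT (r : borelType V -> borelType Z),
   forall B : set (borelType Z), measurable B -> mm_measure Z B = mu (r @^-1` B),
   forall z, measure_support mu (i z) &
   forall v, measure_support mu v -> i (r v) = v].
Proof.
pose S := measure_support mu.
pose S0 : S !=set0 := measure_support_neq0.
pose cS : closed S := measure_support_closed.
pose T : completeMetricType R := subrv S0 cS.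
pose r : V -> T := rv_proj S0 cS.
have mr : measurable_fun setT (r : borelType V -> borelType T) by exact: rv_proj_measurable.
have [nu nuE] := pushforward_probability mu mr.
have supp : measure_support nu = setT.
  apply/seteqP; split => // z _ U oU Uz; have nuU := nuE U (open_borel oU).
  change (0 < nu U); rewrite nuU => {nuU}.
  have /nbhs_ballP[e/= e0 eU] := open_nbhs_nbhs (conj oU Uz).
  have : 0 < mu (ball (rv_val z) e).
    by apply: (rv_valP z); [exact: ball_open|exact: ballxx].
  have mB : measurable (ball (rv_val z) e : set (borelType V)).
    by apply: open_borel; exact: ball_open.
  have mS : measurable (S : set (borelType V)) by exact: closed_borel.
  have -> : mu (ball (rv_val z) e) = mu (ball (rv_val z) e `&` S).
    by rewrite (measureI_conull mB mS)//; exact: measure_supportC0.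
  move/lt_le_trans; apply; rewrite le_measure ?inE//.
  - exact: measurableI.
  - by rewrite -[X in measurable X]setTI; apply: mr => //; exact: open_borel.
  - by move=> v [zv Sv]; apply: eU; rewrite rv_ball/= rv_projK.
exists (MMSpace (subrv_separable S0 cS) supp), (@rv_val _ _ _ S0 cS), r.
split => //.
- exact: rv_valP.
- exact: rv_projK.
Qed.

End support.

(** * Box distance and parameters *)

Section uniform.
Context {R : realType}.
Local Open Scope ereal_scope.

(** As a probability on the whole line it lets parameters, which matter only on [0, 1), be handled
    as total measurable maps. *)
Definition unif : set (measurableTypeR R) -> \bar R :=
  mrestr lebesgue_measure (measurable_itv `[0%R, 1%R[).

HB.instance Definition _ := Measure.on unif.

Let unifT : unif setT = 1.
Proof. by rewrite /unif /mrestr setTI lebesgue_measure_itv/= lte_fin ltr01 oppr0 adde0. Qed.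

HB.instance Definition _ := Measure_isProbability.Build _ _ _ unif unifT.

Lemma unifE A : unif A = lebesgue_measure (`[0%R, 1%R[ `&` A).
Proof. by rewrite /unif /mrestr setIC. Qed.

Lemma unif_itv (a : R) : (0 <= a <= 1)%R -> unif `]-oo, a] = a%:E.
Proof.
move=> /andP[a0 a1].
rewrite /unif /mrestr; have [->|a1'] := eqVneq a 1%R.
  rewrite setIidr; last by apply: subset_itv; rewrite ?bnd_simp.
  by rewrite lebesgue_measure_itv/= lte_fin ltr01 oppr0 adde0.
rewrite (_ : _ `&` _ = `[0%R, a]%classic); last first.
  apply/seteqP; split => x /=; rewrite !in_itv/=; first by move=> [-> /andP[->]].
  move=> /andP[-> xa]; rewrite xa; split=> //.
  by rewrite (le_lt_trans xa)// lt_neqAle a1'.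
rewrite lebesgue_measure_itv/= lte_fin; case: ltgtP a0 => // [_ _|<- _]; last by [].
by rewrite oppr0 adde0.
Qed.

Lemma is_parameter_unif (X : mmSpace R) (phi : R -> X) :
  measurable_fun setT (phi : measurableTypeR R -> borelType X) ->
  (forall B : set (borelType X), measurable B -> unif (phi @^-1` B) = mm_measure X B) ->
  is_parameter phi.
Proof.
move=> mphi phiE; split; first exact: measurable_funTS.
by move=> B mB; rewrite -phiE// unifE.
Qed.

End uniform.

Section box.
Context {R : realType}.
Local Open Scope ereal_scope.
Implicit Types X Y : mmSpace R.

Lemma box_le X Y (e : R) (phi : R -> X) (psi : R -> Y) (G : set (measurableTypeR R)) :
  (0 <= e)%R -> is_parameter phi -> is_parameter psi -> measurable G ->
  (1 - e)%:E <= unif G ->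
  (forall s t, G s -> G t ->
     (`|mdist (phi s) (phi t) - mdist (psi s) (psi t)| <= e)%R) ->
  box X Y <= e%:E.
Proof.
move=> e0 pphi ppsi mG Ge GP; apply: ereal_inf_lbound; exists e => //; split=> //.
exists phi, psi, (`[0%R, 1%R[ `&` G); split => //.
- by split; [exact: measurableI|exact: subIsetl].
- by rewrite -unifE.
- by move=> s t [_ Gs] [_ Gt]; exact: GP.
Qed.

Lemma box_sym X Y : box X Y = box Y X.
Proof.
suff bb X' Y' : box X' Y' <= box Y' X' by apply/eqP; rewrite eq_le !bb.
apply: le_ereal_inf_tmp => _ [e [e0 [phi [psi [I0 [? ? ? ? IP]]]]] <-].
apply: ereal_inf_lbound; exists e => //; split=> //.
by exists psi, phi, I0; split=> // s t Is It; rewrite distrC; exact: IP.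
Qed.

(** The times of [I0] that [phi] spends in [A i] are sent to [Y] by [psi]. Discarding the times
    outside [I0] costs at most [e] in mass, and the distortion costs at most [e] in distance. *)
Lemma box_sep_family X Y (e : R) N (k : 'I_N.+1 -> R) (D : R) :
  box X Y < e%:E -> sep_family X k D ->
  sep_family Y (fun i => k i - e)%R (D - e)%R.
Proof.
move=> /ereal_inf_lt[_ [e' [e'0 [phi [psi [I0 [[mphi phiE] [mpsi psiE] [mI0 I01] I0e IP]]]]] <-]].
rewrite lte_fin => e'e [A [mA Ak AD]].
pose B i : set Y := closure (psi @` (phi @^-1` A i `&` I0)).
have mB i : measurable (B i : set (borelType Y)) by apply: closed_borel; exact: closed_closure.
exists B; split => // [i|i j x y ij Bx By].
  have mDA : measurable (`[0%R, 1%R[ `&` phi @^-1` A i : set (measurableTypeR R)) by exact: mphi.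
  have AI : (k i - e)%:E <= lebesgue_measure ((`[0%R, 1%R[ `&` phi @^-1` A i) `&` I0).
    have kA : (k i)%:E <= lebesgue_measure ((`[0%R, 1%R[ `&` phi @^-1` A i)) by rewrite phiE.
    have lebE F : F `<=` `[0%R, 1%R[ -> lebesgue_measure F = unif F.
      by move=> F01; rewrite unifE setIidr.
    move: kA I0e; rewrite !lebE//; last by move=> t [[]].
    have mI := measurableI _ _ mDA mI0.
    rewrite !prE// !lee_fin => kA I0e; have := prI_ge unif mDA mI0; lra.
  apply: (le_trans AI); rewrite -psiE// le_measure ?inE//.
  - exact: measurableI.
  - exact: mpsi.
  - by move=> t [[t01 At] It]; split=> //; apply: subset_closure; exists t.
apply: closure_mdist_ge Bx By => _ _ [s [As Is] <-] [t [At It] <-].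
have := IP _ _ Is It; rewrite ler_norml => /andP[_].
have := AD _ _ _ _ ij As At; lra.
Qed.

End box.

(** * Quantile functions *)

Section quantile.
Context {R : realType}.

Lemma probability_eq_rays (P Q : probability (measurableTypeR R) R) :
  (forall x : R, P `]-oo, x]%classic = Q `]-oo, x]%classic) -> forall B, measurable B -> P B = Q B.
Proof.
move=> PQ; apply: (@measure_unique _ R (measurableTypeR R) (@RGenOInfty.G R) (fun n => `](- n%:R)%R, +oo[%classic) _ _ _ _ P Q).
- exact: RGenOInfty.measurableE.
- move=> A B [x ->] [y ->]; exists (Num.max x y).
  by apply/seteqP; split => z /=; rewrite !in_itv/= !andbT gt_max => /andP.
- by move=> n; exists (- n%:R).
- apply/seteqP; split => // x _; exists (Num.bound `|x|) => //=.
  by rewrite in_itv/= andbT ltrNl (le_lt_trans (ler_norm _))// normrN archi_boundP.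
- move=> _ [x ->].
  have rayE (Q' : probability (measurableTypeR R) R) :
      Q' `]x, +oo[%classic = (1 - Q' `]-oo, x]%classic)%E.
    by rewrite -setCitvl probability_setC.
  by apply: (etrans (rayE P)); rewrite PQ; exact: esym (rayE Q).
- by move=> n; rewrite (le_lt_trans (probability_le1 _ _))// ltry.
Qed.

(** [q] is the generalized inverse of the distribution function [F]. Right continuity of [F] makes
    [q t <= x] equivalent to [t <= F x], so both laws agree on rays. *)
Lemma quantile d (T : measurableType d) (P : probability T R) (X : T -> R) (c : R) :
  measurable_fun setT X -> (forall w, 0 <= X w <= c) ->
  exists q : R -> R, [/\ {homo q : s t / s <= t}, forall t, 0 <= q t <= c &
    forall B : set (measurableTypeR R), measurable B -> unif (q @^-1` B) = P (X @^-1` B)].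
Proof.
move=> mX Xc; have c0 : 0 <= c by have /andP[/le_trans] := Xc point; exact.
pose F x := pr P (X @^-1` `]-oo, x]).
have mXr x : measurable (X @^-1` `]-oo, x]) by rewrite -[X in measurable X]setTI; exact: mX.
have F_homo x y : x <= y -> F x <= F y.
  by move=> xy; apply: pr_le => // w /=; rewrite !in_itv/= => /le_trans; apply.
have F_right t x : (forall y, x < y -> t <= F y) -> t <= F x.
  move=> tF; pose XF : {RV P >-> R} := HB.pack X (isMeasurableFun.Build _ _ _ _ X mX).
  have Fcvg := @cdf_right_continuous _ _ _ P XF x.
  rewrite -lee_fin -prE//.
  change (t%:E <= cdf XF x)%E.
  rewrite -(cvg_lim _ Fcvg)//; apply: lime_ge; first by apply/cvg_ex; eexists; exact: Fcvg.
  near=> y; change (t%:E <= P (X @^-1` `]-oo, y]))%E; rewrite prE// lee_fin; apply: tF.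
  by near: y; exact: nbhs_right_gt.
have Fc x : c <= x -> F x = 1.
  move=> cx; rewrite /F (_ : _ @^-1` _ = setT) ?prT//; apply/seteqP; split => // w _ /=.
  by rewrite in_itv/=; have /andP[_ /le_trans] := Xc w; apply.
(* The alternative [c <= x] keeps [S t] nonempty even for [t > 1], so [q] is monotone with values in
   [0, c] on the whole line. *)
pose S t := [set x | 0 <= x /\ (t <= F x \/ c <= x)].
have Sc t : S t c by split=> //; right.
have Slb t : has_lbound (S t) by exists 0 => x [].
pose q t := inf (S t).
have q_homo s t : s <= t -> q s <= q t.
  move=> st; apply: lb_le_inf; first by exists c.
  move=> x [x0 tFx]; apply: ge_inf => //; split=> //.
  by case: tFx => [/(le_trans st)|]; [left|right].
have qP t x : 0 < t <= 1 -> (q t <= x) = (t <= F x).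
  move=> /andP[t0 t1]; apply/idP/idP => [qx|tF]; last first.
    apply: ge_inf => //; split; last by left.
    rewrite leNgt; apply/negP => x0; move: tF; rewrite leNgt => /negP; apply.
    rewrite /F (_ : _ @^-1` _ = set0) ?/pr ?measure0//; apply/seteqP; split => // w /=.
    by rewrite in_itv/= leNgt => /negP; apply; have /andP[/(lt_le_trans x0)] := Xc w.
  apply: F_right => y xy.
  have [z [z0 zP] zy] := inf_lt (ex_intro (S t) c (Sc t)) (le_lt_trans qx xy).
  apply: (le_trans _ (F_homo _ _ (ltW zy))).
  by case: zP => // /Fc ->.
have mq : measurable_fun setT (q : measurableTypeR R -> measurableTypeR R).
  exact: nondecreasing_measurable.
exists q; split => //.
  move=> t; apply/andP; split; last exact: ge_inf.
  by apply: lb_le_inf; [exists c|move=> x []].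
have [Q1 Q1E] := pushforward_probability (unif : probability _ R) mq.
have mX' : measurable_fun setT (X : T -> measurableTypeR R) by exact: mX.
have [Q2 Q2E] := pushforward_probability P mX'.
move=> B mB; rewrite -Q1E// -Q2E//.
have QQ : forall x : R, Q1 `]-oo, x]%classic = Q2 `]-oo, x]%classic; last first.
  exact: (@probability_eq_rays Q1 Q2 QQ B mB).
move=> x.
rewrite Q1E// Q2E//.
(* At [t = 0] the equivalence [qP] breaks down for negative [x]; the comparison is therefore made on
   the conull open interval. *)
have m01 : measurable (`]0, 1[%classic : set (measurableTypeR R)) by [].
have unif01 : unif (~` `]0, 1[) = 0%E :> \bar R.
  have u1 : unif `]0, 1[ = 1%E :> \bar R.
    rewrite unifE setIidr; last by apply: subset_itvr; rewrite bnd_simp.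
    by rewrite lebesgue_measure_itv/= lte_fin ltr01 oppr0 adde0.
  apply: (etrans (probability_setC (unif : probability _ R) m01)).
  by rewrite [X in (1 - X)%E](_ : _ = 1%E) ?subee//; exact: u1.
have mqx : measurable (q @^-1` `]-oo, x] : set (measurableTypeR R)).
  by rewrite -[X in measurable X]setTI; exact: mq.
rewrite -(measureI_conull mqx m01 unif01).
have -> : q @^-1` `]-oo, x] `&` `]0, 1[ = `]-oo, F x] `&` `]0, 1[.
  apply/seteqP; split => t /=; rewrite !in_itv/= => -[tx t01]; split=> //;
    by move: tx; rewrite qP//; case/andP: t01 => -> /ltW.
rewrite [RHS]prE//; apply: (etrans (measureI_conull _ m01 unif01)) => //.
by apply: unif_itv; rewrite pr_ge0 pr_le1.
Unshelve. all: by end_near. Qed.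

End quantile.

(** * Coding of Polish spaces by reals *)

(* In base 3 the digits 0 and 1 can be read off a real by thresholding. *)
Section ternary_code.
Context {R : realType}.
Implicit Types (c : nat -> bool) (r : R).

Fixpoint tcode_part (n : nat) c : R :=
  if n is m.+1 then (c 0%N)%:R + tcode_part m (c \o S) / 3 else 0.

Lemma tcode_part_bound n c : 0 <= tcode_part n c <= 3 / 2.
Proof.
elim: n c => [|n IHn] c /=; first by apply/andP; split; lra.
have /andP[] := IHn (c \o S); case: (c 0%N) => /= *; apply/andP; split; lra.
Qed.

Lemma tcode_part_nd c : nondecreasing_seq (fun n => tcode_part n c).
Proof.
apply/nondecreasing_seqP => n; elim: n c => [|n IHn] c.
  by have /andP[] := tcode_part_bound 1 c.
by rewrite -[leRHS]/(_ + _) /= lerD2l ler_pM2r ?invr_gt0//; exact: IHn.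
Qed.

Definition tcode c : R := limn (fun n => tcode_part n c).

Lemma cvg_tcode c : (fun n => tcode_part n c) @ \oo --> tcode c.
Proof.
apply: nondecreasing_is_cvgn; first exact: tcode_part_nd.
by exists (3 / 2) => _ [n _ <-]; have /andP[] := tcode_part_bound n c.
Qed.

Lemma tcode_bound c : 0 <= tcode c <= 3 / 2.
Proof.
apply/andP; split.
  apply: limr_ge; first by apply/cvg_ex; exists (tcode c); exact: cvg_tcode.
  by apply: nearW => n; have /andP[] := tcode_part_bound n c.
apply: limr_le; first by apply/cvg_ex; exists (tcode c); exact: cvg_tcode.
by apply: nearW => n; have /andP[] := tcode_part_bound n c.
Qed.

Lemma tcodeS c : tcode c = (c 0%N)%:R + tcode (c \o S) / 3.
Proof.
apply: (@cvg_unique _ _ ((fun n => tcode_part n.+1 c) @ \oo)) => //.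
  by have := @cvg_tcode c; rewrite -(cvg_shiftS (fun n => tcode_part n c)).
by apply: cvgD; [exact: cvg_cst|apply: cvgMl; exact: cvg_tcode].
Qed.

(** Removes the leading digit and shifts: the code of a sequence goes to the code of its tail. *)
Definition tstep r := 3 * (r - (1 <= r)%R%:R).
Definition tdigit m r := 1 <= iter m tstep r.

(** The tail adds at most [(3 / 2) / 3 = 1 / 2] to the leading digit, so the threshold 1 decides
    it. *)
Lemma tcode_ge1 c : (1 <= tcode c) = c 0%N.
Proof.
rewrite tcodeS; have := tcode_bound (c \o S); case: (c 0%N) => /= /andP[] *;
  [apply/idP|apply/negbTE; rewrite -ltNge]; lra.
Qed.

Lemma tdigit_tcode m c : tdigit m (tcode c) = c m.
Proof.
rewrite /tdigit; elim: m c => [|m IHm] c; first exact: tcode_ge1.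
rewrite iterSr (_ : tstep (tcode c) = tcode (c \o S)); first exact: IHm.
by rewrite /tstep tcode_ge1 tcodeS; lra.
Qed.

Lemma tstep_measurable : measurable_fun setT tstep.
Proof.
apply: measurable_funM => //; apply: measurable_funB => //.
rewrite (_ : (fun _ => _) = \1_(`[1, +oo[%classic : set R)); first exact: measurable_indic.
by apply/funext => r; rewrite indicE mem_setE in_itv/= andbT.
Qed.

Lemma tdigit_measurable m : measurable [set r : R | tdigit m r].
Proof.
have mi : measurable_fun setT (iter m tstep).
  elim: m => [|m IHm]; first exact: measurable_id.
  exact: (measurableT_comp tstep_measurable IHm).
rewrite (_ : [set _ | _] = iter m tstep @^-1` `[1, +oo[).
  by rewrite -[X in measurable X]setTI; exact: mi.
by apply/seteqP; split => r /=; rewrite in_itv/= andbT.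
Qed.

Lemma tcode_measurable d (T : measurableType d) (b : T -> nat -> bool) :
  (forall m, measurable [set x | b x m]) -> measurable_fun setT (fun x => tcode (b x)).
Proof.
move=> mb; apply: (@measurable_fun_cvg _ _ _ _ (fun n x => tcode_part n (b x))); last first.
  by move=> x _; exact: cvg_tcode.
move=> n; elim: n b mb => [|n IHn] b mb //=.
apply: measurable_funD.
  rewrite (_ : (fun _ => _) = \1_[set x | b x 0%N]); first exact: measurable_indic.
  by apply/funext => x; rewrite indicE mem_setE.
by apply: measurable_funM => //; exact: (IHn (fun x => b x \o S) (fun m => mb m.+1)).
Qed.

End ternary_code.

Section metric_limit.
Context {R : realType} (X : completeMetricType R).

(** The points whose [1/(m+1)]-ball lies in [U] form a closed set [F m], and [h t] is in [U] exactly
    when, for some [m], the [z k t] are eventually in [F m]. *)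
Lemma metric_cvg_measurable d (T : measurableType d) (z : nat -> T -> X) (h : T -> X) :
  (forall k, measurable_fun setT (z k : T -> borelType X)) ->
  (forall t e, 0 < e -> exists K, forall k, (K <= k)%N -> mdist (z k t) (h t) < e) ->
  measurable_fun setT (h : T -> borelType X).
Proof.
move=> mz zh; apply: borel_measurable => U oU.
pose F m : set X := [set x | forall y, mdist x y < m.+1%:R^-1 -> U y].
have cF m : closed (F m).
  rewrite -[F m]setCK; apply: open_closedC.
  rewrite (_ : ~` F m = \bigcup_(y in ~` U) ball y m.+1%:R^-1).
    by apply: bigcup_open => y _; exact: ball_metric_open.
  apply/seteqP; split => [x /existsNP[y /not_implyP[xy Uy]]|x [y Uy xy] /(_ y) H].
    by exists y => //; rewrite ballEmdist/= metric_sym.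
  by apply: Uy; apply: H; rewrite ballEmdist/= in xy; rewrite metric_sym.
rewrite (_ : h @^-1` U = \bigcup_m \bigcup_K \bigcap_(k in [set k | (K <= k)%N]) z k @^-1` F m).
  apply: bigcupT_measurable => m; apply: bigcupT_measurable => K.
  apply: bigcap_measurableType => k _.
  by rewrite -[X in measurable X]setTI; apply: mz => //; exact: closed_borel.
apply/seteqP; split => t.
  move=> Ut; have /nbhs_ballP[e/= e0 eU] := open_nbhs_nbhs (conj oU Ut).
  have [m me] := small_inv (divr_gt0 e0 (ltr0n _ 2)).
  have [K zK] := zh t (e / 2) ltac:(by rewrite divr_gt0).
  exists m => //; exists K => // k /= Kk y zy; apply: eU; rewrite ballEmdist/=.
  rewrite (le_lt_trans (metric_triangle _ (z k t) _))// (splitr e) ltrD//.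
    by rewrite metric_sym zK.
  exact: lt_trans me.
move=> [m _ [K _ FK]]; have [K' zK'] := zh t m.+1%:R^-1 ltac:(by rewrite invr_gt0).
by apply: (FK (maxn K K')) => /=; rewrite ?leq_maxl// zK'// leq_maxr.
Qed.

End metric_limit.

Section measurable_nat.
Context d (T : measurableType d).

Lemma nat_preimage_measurable (nu : T -> nat) (A : set nat) :
  (forall n, measurable (nu @^-1` [set n])) -> measurable (nu @^-1` A).
Proof.
move=> mnu; rewrite (_ : nu @^-1` A = \bigcup_(n in A) nu @^-1` [set n]).
  by apply: bigcup_measurable => n _; exact: mnu.
by apply/seteqP; split => [t At|t [n An /= nE]]; [exists (nu t)|rewrite /= nE].
Qed.

Lemma nat2_preimage_measurable (nu nu' : T -> nat) (C : nat -> nat -> Prop) :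
  (forall n, measurable (nu @^-1` [set n])) ->
  (forall n, measurable (nu' @^-1` [set n])) ->
  measurable [set t | C (nu t) (nu' t)].
Proof.
move=> mnu mnu'.
rewrite (_ : [set _ | _] = \bigcup_n (nu @^-1` [set n] `&` nu' @^-1` [set m | C n m])).
  apply: bigcupT_measurable => n; apply: measurableI; first exact: mnu.
  exact: nat_preimage_measurable.
apply/seteqP; split => [t Ct|t [n _ [nE Cn]]]; first by exists (nu t).
by move: nE Cn => /= ->.
Qed.

(* The value 0 is also taken where no bit is set. *)
Definition first_bit (b : nat -> bool) : nat :=
  if pselect (exists n, b n) is left H then ex_minn H else 0%N.

Lemma first_bitP (b : nat -> bool) n : b n -> b (first_bit b).
Proof.
by move=> bn; rewrite /first_bit; case: pselect => [H|[]]; [case: ex_minnP|exists n].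
Qed.

Lemma first_bit_measurable (b : T -> nat -> bool) :
  (forall n, measurable [set t | b t n]) ->
  forall n, measurable ((first_bit \o b) @^-1` [set n]).
Proof.
move=> mb n.
pose L := [set t | b t n] `&` \bigcap_(m in `I_n) ~` [set t | b t m].
have mL : measurable L.
  by apply: measurableI => //; apply: bigcap_measurableType => m _; exact: measurableC.
have LE t : L t -> first_bit (b t) = n.
  move=> [bn bm]; rewrite /first_bit; case: pselect => [H|[]]; last by exists n.
  case: ex_minnP => k bk kmin; apply/eqP; rewrite eqn_leq kmin// leqNgt.
  by apply/negP => kn; exact: (bm k).
(* The region where no bit is set, which only counts for the default value [n = 0]. *)
pose Z : set T := if n is 0%N then \bigcap_m ~` [set t | b t m] else set0.
have mZ : measurable Z.
  by rewrite /Z; case: (n) => // ; apply: bigcapT_measurable => m; exact: measurableC.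
rewrite (_ : _ @^-1` _ = L `|` Z); first exact: measurableU.
apply/seteqP; split => t /=.
  rewrite /first_bit; case: pselect => [H|H n0].
    case: ex_minnP => k bk kmin kn; left; subst k; split=> // m /= mn bm.
    by have := kmin _ bm; rewrite leqNgt mn.
  by right; rewrite /Z -n0 => m _ bm; apply: H; exists m.
case=> [/LE//|]; rewrite /Z; case: (n) => // bt.
by rewrite /first_bit; case: pselect => // -[m bm]; case: (bt m).
Qed.

End measurable_nat.

Lemma dense_sequence {R : realType} (X : mmSpace R) :
  exists xs : nat -> X, forall x e, 0 < e -> exists n, mdist (xs n) x < e.
Proof.
have [D cD dD] := mm_separable X.
have D0 : D !=set0.
  have [x [_ Dx]] := dD setT (ex_intro _ point I) openT; by exists x.
have [xs xsD] : exists xs : nat -> X, D `<=` range xs.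
  have [D0'|/surjfunPex[xs ->]] := pfcard_geP cD; first by move: D0; rewrite D0' => -[].
  by exists xs.
exists xs => x e e0.
have [y [xy Dy]] := dD (ball x e) (ex_intro _ x (ballxx x e0)) (ball_metric_open x e).
have [n _ nE] := xsD _ Dy; exists n; rewrite nE metric_sym.
by rewrite ballEmdist in xy.
Qed.

Section polish_code.
Context {R : realType} (X : mmSpace R).

(* Every point is coded by a real: bit (k, n) of the code of [x] tells whether [x]
   is [1/(k+1)]-close to the n-th point of a dense sequence. *)
Lemma polish_code : exists (g : X -> R) (h : R -> X), [/\
  measurable_fun setT (g : borelType X -> R), forall x, 0 <= g x <= 3 / 2,
  measurable_fun setT (h : measurableTypeR R -> borelType X) & forall x, h (g x) = x].
Proof.
have [xs xs_near] := dense_sequence X.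
pose b x m := if @unpickle (nat * nat)%type m is Some p then mdist (xs p.2) x < p.1.+1%:R^-1 else false.
have mb m : measurable ([set x | b x m] : set (borelType X)).
  rewrite /b; case: unpickle => [p|]; last by rewrite (_ : [set _ | _] = set0)//; apply/seteqP; split.
  have := open_borel (ball_metric_open (xs p.2) p.1.+1%:R^-1 : open (_ : set X)).
  by rewrite ballEmdist.
pose nu (k : nat) (r : R) : nat := first_bit (fun n => tdigit (pickle (k, n)) r).
have mnu k n : measurable (nu k @^-1` [set n] : set (measurableTypeR R)).
  by apply: first_bit_measurable => m; exact: tdigit_measurable.
(* Two centres within [1/(k+1)] and [1/(l+1)] of a common point satisfy this, so [G] contains every
   code. On [G] the decoded sequence is Cauchy; elsewhere [z] is constant, so a limit exists for
   every real. *)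
pose C (k l i j : nat) : bool := mdist (xs i) (xs j) <= 2 / (minn k l).+1%:R.
pose G : set (measurableTypeR R) := \bigcap_k \bigcap_l [set r | C k l (nu k r) (nu l r)].
have mG : measurable G.
  apply: bigcapT_measurable => k; apply: bigcapT_measurable => l.
  exact: (nat2_preimage_measurable (fun i j => is_true (C k l i j)) (mnu k) (mnu l)).
pose z k r : X := if `[< G r >] then xs (nu k r) else point.
have z_cvg r : exists l : X, forall e, 0 < e -> exists K, forall k, (K <= k)%N -> mdist (z k r) l < e.
  have [Gr|Gr] := pselect (G r); last first.
    exists point => e e0; exists 0%N => k _; rewrite /z; case: asboolP => // _.
    by rewrite mdistxx.
  have cz : cauchy ((z ^~ r) @ \oo).
    apply: cauchy_exP => e e0; have [k ke] := small_inv (divr_gt0 e0 (ltr0n _ 2)).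
    exists (z k r); change (\forall l \near \oo, ball (z k r) e (z l r)).
    near=> l; rewrite ballEmdist/= /z; case: asboolP => // _.
    have kl : (k <= l)%N by near: l; exact: nbhs_infty_ge.
    have := Gr k I l I; rewrite /= /C (minn_idPl kl) => /le_lt_trans; apply.
    by rewrite -ltr_pdivlMl// mulrC.
  have /cvg_ex[l zl] : cvg ((z ^~ r) @ \oo) by exact: cauchy_cvg.
  exists l => e e0; move/cvg_ballP/(_ _ e0) : zl => [K _ KP].
  by exists K => k /KP; rewrite ballEmdist/= metric_sym.
have [h hP] := choice z_cvg.
exists (fun x => tcode (b x)), h; split.
- exact: tcode_measurable.
- by move=> x; exact: tcode_bound.
- apply: (@metric_cvg_measurable _ _ _ _ z) => // k _ B mB; rewrite setTI.
  pose B0 : set R := if `[< B point >] then ~` G else set0.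
  have mB0 : measurable (B0 : set (measurableTypeR R)).
    by rewrite /B0; case: asboolP => // _; exact: measurableC.
  rewrite (_ : _ @^-1` _ = (G `&` (nu k @^-1` [set n | B (xs n)])) `|` B0).
    by apply: measurableU => //; apply: measurableI => //; exact: nat_preimage_measurable.
  apply/seteqP; split => r /=; rewrite /z /B0.
    by case: asboolP => Gr Br; [left|right; case: asboolP].
  case=> [[Gr]|]; first by case: asboolP.
  by case: (asboolP (B point)) => // Bp Gr; case: asboolP.
- move=> x; apply/mdist_positivity/eqP; rewrite eq_le mdist_ge0 andbT.
  have nuP k : mdist (xs (nu k (tcode (b x)))) x < k.+1%:R^-1.
    have [n xn] := xs_near x k.+1%:R^-1 ltac:(by rewrite invr_gt0).
    have bE m : tdigit (pickle (k, m)) (tcode (b x) : R) = (mdist (xs m) x < k.+1%:R^-1).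
      by rewrite tdigit_tcode /b pickleK.
    have := @first_bitP (fun m => tdigit (pickle (k, m)) (tcode (b x) : R)) n.
    by rewrite -/(nu k (tcode (b x))) !bE; apply.
  have Gx : G (tcode (b x)).
    move=> k _ l _; rewrite /= /C (le_trans (metric_triangle _ x _))//.
    rewrite (_ : 2 / _ = (minn k l).+1%:R^-1 + (minn k l).+1%:R^-1); last by rewrite mulr_natl mulr2n.
    rewrite lerD//.
      by rewrite (le_trans (ltW (nuP k)))// lef_pV2 ?posrE// ler_nat ltnS geq_minl.
    by rewrite metric_sym (le_trans (ltW (nuP l)))// lef_pV2 ?posrE// ler_nat ltnS geq_minr.
  apply/ler_addgt0Pl => e e0; rewrite addr0.
  have [K KP] := hP (tcode (b x)) (e / 2) ltac:(by rewrite divr_gt0).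
  have [k ke] := small_inv (divr_gt0 e0 (ltr0n _ 2)).
  have := KP (maxn K k) (leq_maxl _ _); rewrite /z; case: asboolP => // _ zh.
  rewrite (le_trans (metric_triangle _ (xs (nu (maxn K k) (tcode (b x)))) _))//.
  rewrite (splitr e) lerD//; first by rewrite metric_sym ltW.
  rewrite ltW// (lt_trans (nuP _))// (le_lt_trans _ ke)//.
  by rewrite lef_pV2 ?posrE// ler_nat ltnS leq_maxr.
Unshelve. all: by end_near. Qed.

End polish_code.

(** * Aligned parameters *)

Section strip.
Context {R : realType}.

(** Iterated, it recovers [s] from [2 * k + s]: codes are at most [3 / 2], below the step 2, so they
    are left fixed. *)
Definition dstep (r : R) : R := r - 2 * (2 <= r)%R%:R.

Lemma dstep_measurable : measurable_fun setT dstep.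
Proof.
apply: measurable_funB => //; apply: measurable_funM => //.
rewrite (_ : (fun _ => _) = \1_(`[2, +oo[%classic : set R)); first exact: measurable_indic.
by apply/funext => r; rewrite indicE mem_setE in_itv/= andbT.
Qed.

Lemma iter_dstep_measurable M : measurable_fun setT (iter M dstep).
Proof.
elim: M => [|M IHM]; first exact: measurable_id.
exact: (measurableT_comp dstep_measurable IHM).
Qed.

Lemma iter_dstep M k (s : R) : (k <= M)%N -> 0 <= s <= 3 / 2 ->
  iter M dstep (2 * k%:R + s) = s.
Proof.
move=> kM /andP[s0 s2]; elim: M k kM => [|M IHM] [|k] kM; rewrite ?mulr0 ?add0r ?iterSr//.
  rewrite {2}/dstep leNgt (_ : s < 2); last by lra.
  by rewrite mulr0 subr0; have := IHM 0%N (leq0n _); rewrite mulr0 add0r.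
rewrite (_ : dstep _ = 2 * k%:R + s); first exact: IHM.
have k0 : 0 <= k%:R :> R by [].
rewrite /dstep -natr1 (_ : 2 <= _ = true); last by apply/idP; lra.
by rewrite /=; lra.
Qed.

End strip.

(** For nested sets the mass of the symmetric difference is the difference of the masses. *)
Lemma pr_symdiff {R : realType} d (T : measurableType d) (P : probability T R)
  (A B : set T) (e : R) : measurable A -> measurable B ->
  A `<=` B \/ B `<=` A -> `|pr P A - pr P B| <= e ->
  1 - e <= pr P (~` ((A `\` B) `|` (B `\` A))).
Proof.
move=> mA mB AB ABe; have mAB := measurableD mA mB; have mBA := measurableD mB mA.
rewrite prC; last exact: measurableU.
rewrite lerD2l lerN2; move: ABe; rewrite ler_norml => /andP[].
have := prDI P mA mB; have := prDI P mB mA; rewrite (setIC B A).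
have pr0 : pr P set0 = 0 by rewrite /pr measure0.
case: AB => AB.
  have -> : A `\` B = set0 by apply/seteqP; split => // t [At []]; exact: AB.
  by rewrite set0U pr0; lra.
have -> : B `\` A = set0 by apply/seteqP; split => // t [At []]; exact: AB.
by rewrite setU0 pr0; lra.
Qed.

Section indexed_parameter.
Context {R : realType}.

(* The quantile function of [2 * k + code] passes through the fibers of [k] in
   increasing order. *)
Lemma indexed_parameter (X : mmSpace R) (k : X -> nat) (M : nat) :
  (forall i, measurable (k @^-1` [set i] : set (borelType X))) ->
  (forall x, (k x <= M)%N) ->
  exists (phi : R -> X) (G : set (measurableTypeR R)), [/\
    measurable_fun setT (phi : measurableTypeR R -> borelType X),
    forall B : set (borelType X), measurable B -> unif (phi @^-1` B) = mm_measure X B,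
    measurable G, unif (~` G) = 0%E &
    forall s t, G s -> G t -> s <= t -> (k (phi s) <= k (phi t))%N].
Proof.
move=> mk kM; have [g [h [mg g01 mh hg]]] := polish_code X.
pose f x : R := 2 * (k x)%:R + g x.
have mf : measurable_fun setT (f : borelType X -> R).
  have mkR : measurable_fun setT (fun x : borelType X => (k x)%:R : R).
    move=> _ B mB; rewrite setTI.
    exact: (nat_preimage_measurable [set n | B n%:R] mk).
  by apply: measurable_funD => //; apply: measurable_funM.
have f0c x : 0 <= f x <= 2 * M%:R + 3 / 2.
  have /andP[g0 g2] := g01 x; have : (k x)%:R <= M%:R :> R by rewrite ler_nat.
  have : 0 <= (k x)%:R :> R by [].
  by rewrite /f => *; apply/andP; split; lra.
have [q [q_homo q0c qE]] := quantile (mm_measure X) mf f0c.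
have mq : measurable_fun setT (q : measurableTypeR R -> measurableTypeR R).
  exact: nondecreasing_measurable.
pose h' := h \o iter M dstep.
have mh' : measurable_fun setT (h' : measurableTypeR R -> borelType X).
  exact: (measurableT_comp mh (iter_dstep_measurable M)).
have h'f x : h' (f x) = x by rewrite /h' /= iter_dstep.
(* This is the range of [f], written as a fixed-point set to make it measurable. [q] takes its
   values there almost surely, and there its monotonicity passes to [k], because the step 2 exceeds
   the width [3 / 2] of the codes. *)
pose E : set (measurableTypeR R) := [set r | f (h' r) = r].
have mE : measurable E.
  rewrite (_ : E = (fun r => f (h' r) - r) @^-1` [set 0]).
    rewrite -[X in measurable X]setTI; apply: (measurable_funB _ _) => //.
    exact: (measurableT_comp mf mh').
  by apply/seteqP; split => r /=; rewrite /E/=; [move=> ->; rewrite subrr|move/eqP; rewrite subr_eq0 => /eqP].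
exists (h' \o q), (q @^-1` E); split.
- exact: measurableT_comp.
- move=> B mB; rewrite comp_preimage qE; last by rewrite -[X in measurable X]setTI; exact: mh'.
  by congr (mm_measure X _); apply/seteqP; split => x /=; rewrite h'f.
- by rewrite -[X in measurable X]setTI; exact: mq.
- rewrite preimage_setC qE; last exact: measurableC.
  by rewrite (_ : _ @^-1` _ = set0) ?measure0//; apply/seteqP; split => x //= []; rewrite /E/= h'f.
- move=> s t Es Et /q_homo; rewrite leqNgt => st; apply/negP => kk.
  have fs : f (h' (q s)) = q s := Es.
  have ft : f (h' (q t)) = q t := Et.
  have : (k (h' (q t))).+1%:R <= (k (h' (q s)))%:R :> R by rewrite ler_nat; exact: kk.
  have /andP[g0 g2] := g01 (h' (q s)); have /andP[g0' g2'] := g01 (h' (q t)).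
  have st' : f (h' (q s)) <= f (h' (q t)) by rewrite fs ft.
  rewrite -natr1; move: st'; rewrite /f; lra.
Qed.

(* The sublevel sets of both indices become initial segments of [0, 1), so they
   differ by no more than their masses do. *)
Lemma matched_parameters (X Y : mmSpace R) (kX : X -> nat) (kY : Y -> nat) (M : nat) (e : R) :
  0 <= e ->
  (forall i, measurable (kX @^-1` [set i] : set (borelType X))) ->
  (forall i, measurable (kY @^-1` [set i] : set (borelType Y))) ->
  (forall x, (kX x <= M)%N) -> (forall y, (kY y <= M)%N) ->
  (forall i, (i < M)%N -> `|pr (mm_measure X) [set x | (kX x <= i)%N] -
                 pr (mm_measure Y) [set y | (kY y <= i)%N]| <= e) ->
  exists (phi : R -> X) (psi : R -> Y) (G : set (measurableTypeR R)), [/\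
    measurable_fun setT (phi : measurableTypeR R -> borelType X) /\
    (forall B : set (borelType X), measurable B -> unif (phi @^-1` B) = mm_measure X B),
    measurable_fun setT (psi : measurableTypeR R -> borelType Y) /\
    (forall B : set (borelType Y), measurable B -> unif (psi @^-1` B) = mm_measure Y B),
    measurable G, 1 - M%:R * e <= pr unif G &
    forall t, G t -> kX (phi t) = kY (psi t)].
Proof.
move=> e0 mkX mkY kXM kYM kXY.
have [phi [G1 [mphi phiE mG1 G10 phiG]]] := indexed_parameter mkX kXM.
have [psi [G2 [mpsi psiE mG2 G20 psiG]]] := indexed_parameter mkY kYM.
pose G := G1 `&` G2; have mG : measurable G by exact: measurableI.
pose A (i : nat) : set (measurableTypeR R) := phi @^-1` [set x | (kX x <= i)%N] `&` G.
pose B (i : nat) : set (measurableTypeR R) := psi @^-1` [set y | (kY y <= i)%N] `&` G.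
have mX i : measurable ([set x | (kX x <= i)%N] : set (borelType X)).
  exact: (nat_preimage_measurable [set n | (n <= i)%N] mkX).
have mY i : measurable ([set x | (kY x <= i)%N] : set (borelType Y)).
  exact: (nat_preimage_measurable [set n | (n <= i)%N] mkY).
have mphiX i : measurable (phi @^-1` [set x | (kX x <= i)%N] : set (measurableTypeR R)).
  by rewrite -[X in measurable X]setTI; exact: mphi.
have mpsiY i : measurable (psi @^-1` [set x | (kY x <= i)%N] : set (measurableTypeR R)).
  by rewrite -[X in measurable X]setTI; exact: mpsi.
have mA i : measurable (A i) by exact: measurableI.
have mB i : measurable (B i) by exact: measurableI.
have G0 : pr unif G = 1.
  have p1 : pr unif G1 = 1.
    by have := prC unif mG1; have Z : pr unif (~` G1) = 0 := congr1 fine G10; lra.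
  have p2 : pr unif G2 = 1.
    by have := prC unif mG2; have Z : pr unif (~` G2) = 0 := congr1 fine G20; lra.
  apply/eqP; rewrite eq_le (pr_le1 unif mG)/=.
  by have := prI_ge unif mG1 mG2; rewrite p1 p2 addrK.
have GI (C : set (measurableTypeR R)) : measurable C -> pr unif (C `&` G) = pr unif C.
  move=> mC; have mCG := measurableI _ _ mC mG.
  apply/eqP; rewrite eq_le; apply/andP; split; first exact: (pr_le unif mCG mC).
  by have := prI_ge unif mC mG; rewrite G0 addrK.
have prA i : pr unif (A i) = pr (mm_measure X) [set x | (kX x <= i)%N].
  by rewrite GI//; exact: (congr1 fine (phiE _ (mX i))).
have prB i : pr unif (B i) = pr (mm_measure Y) [set x | (kY x <= i)%N].
  by rewrite GI//; exact: (congr1 fine (psiE _ (mY i))).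
pose H (i : nat) : set (measurableTypeR R) := ~` ((A i `\` B i) `|` (B i `\` A i)).
have mAB i : measurable (A i `\` B i) by exact: measurableD.
have mBA i : measurable (B i `\` A i) by exact: measurableD.
have AB i : A i `<=` B i \/ B i `<=` A i.
  have [?|/existsNP[s /not_implyP[[As Gs] Bs]]] := pselect (A i `<=` B i); first by left.
  right => t [Bt Gt]; split=> //; apply: contrapT => At.
  have [st|ts] := leP s t.
    by apply: Bs; split => //; exact: leq_trans (psiG _ _ Gs.2 Gt.2 st) Bt.
  by apply: At; exact: leq_trans (phiG _ _ Gt.1 Gs.1 (ltW ts)) As.
have mH i : measurable (H i) by apply: measurableC; exact: measurableU.
pose H' (i : nat) : set (measurableTypeR R) := if (i < M)%N then H i else setT.
have He i : 1 - e <= pr unif (H' i).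
  rewrite /H'; case: ifPn => iM; last by rewrite prT lerBlDr lerDl.
  by apply: pr_symdiff => //; rewrite prA prB; exact: kXY.
have mH' i : measurable (H' i) by rewrite /H'; case: ifP.
pose K := \bigcap_(i in `I_M) H' i.
have mK : measurable K by exact: bigcap_measurableType.
exists phi, psi, (K `&` G); split=> //.
- exact: measurableI.
- by rewrite GI//; exact: pr_bigcap_ge.
- move=> t [Kt Gt].
  (* Both indices are at most [M], so they are determined by their sublevel sets at the levels below
     [M]. *)
  have KP i : (i < M)%N -> ((kX (phi t) <= i) = (kY (psi t) <= i))%N.
    move=> iM; have := Kt i iM; rewrite /H' iM => /not_orP[AB1 BA1].
    apply/idP/idP => L; apply: contrapT => N.
      by apply: AB1; split; [split|case].
    by apply: BA1; split; [split|case].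
  apply/eqP; rewrite eqn_leq; apply/andP; split.
    have := kYM (psi t); rewrite leq_eqVlt => /orP[/eqP -> //|/KP ->//].
  have := kXM (phi t); rewrite leq_eqVlt => /orP[/eqP -> //|/KP <-//].
Qed.

End indexed_parameter.

(** * Compactness for measures on an interval *)

Section monotone_functions.
Context {R : realType}.

(** A compact product of uncountably many intervals need not provide convergent subsequences; hence
    the conclusion is closeness on finite sets for arbitrarily late [n]. Monotonicity survives
    because it involves two points at a time. *)
Lemma monotone_cluster (c : R) (q : nat -> R -> R) :
  (forall n, {homo q n : s t / s <= t}) -> (forall n t, 0 <= q n t <= c) ->
  exists q0 : R -> R, [/\ {homo q0 : s t / s <= t}, forall t, 0 <= q0 t <= c &
    forall (e : R) (s : seq R) (N : nat), 0 < e ->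
      exists2 n, (N <= n)%N & forall t, t \in s -> `|q0 t - q n t| < e].
Proof.
move=> q_homo qc.
pose T := prod_topology (fun _ : R => R : topologicalType).
have /= cA := @tychonoff R (fun _ => R) (fun _ => `[0, c]%classic) (fun _ => @segment_compact _ 0 c).
pose F : set_system T := (q : nat -> T) @ \oo.
have FA : F [set f : T | forall t, `[0, c]%classic (f t)].
  by exists 0%N => // n _ t; rewrite /= in_itv/=; exact: qc.
have [q0 [/= q0c q0F]] := cA F _ FA.
have app (e : R) (s : seq R) (N : nat) : 0 < e ->
    exists2 n, (N <= n)%N & forall t, t \in s -> `|q0 t - q n t| < e.
  move=> e0.
  have nb : nbhs (q0 : T) [set g : T | forall t, t \in s -> `|q0 t - g t| < e].
    elim: s => [|a s IHs]; first by apply: filterS filterT => g _ t; rewrite in_nil.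
    have na : nbhs (q0 : T) [set g : T | `|q0 a - g a| < e].
      exact: (@proj_continuous R (fun _ => R) a q0 (ball (q0 a) e) (nbhsx_ballx _ _ e0)).
    apply: filterS (filterI na IHs) => g [ga gs] t; rewrite in_cons => /orP[/eqP ->//|].
    exact: gs.
  have FN : F [set q n | n in [set n | (N <= n)%N]].
    by exists N => // n /= Nn; exists n.
  by have [_ [[n Nn <-] qs]] := q0F _ _ FN nb; exists n.
exists q0; split; [|by move=> t; have := q0c t; rewrite /= in_itv|exact: app].
move=> s t st; rewrite leNgt; apply/negP => ts.
have st0 : 0 < (q0 s - q0 t) / 2 by rewrite divr_gt0// subr_gt0.
have [n _ nst] := app _ [:: s; t] 0%N st0.
have := nst s; rewrite in_cons eqxx => /(_ isT); have := nst t; rewrite !in_cons eqxx orbT => /(_ isT).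
have := q_homo n _ _ st; rewrite !ltr_norml => + /andP[? ?] /andP[? ?]; lra.
Qed.

Lemma unif_itvco (a b : R) : a <= b -> pr unif `[a, b[%classic <= b - a.
Proof.
move=> ab.
have m : measurable (`[a, b[%classic : set (measurableTypeR R)) by [].
rewrite -lee_fin -prE//.
apply: (@le_trans _ _ (lebesgue_measure (`[a, b[%classic : set (measurableTypeR R)))).
  by apply: (le_measure lebesgue_measure); rewrite ?inE//; exact: measurableI.
rewrite lebesgue_measure_itv/= lte_fin; case: ltP => // _.
by rewrite lee_fin subr_ge0.
Qed.

(* The increments of [q] along a grid sum to at most [c], so those above [e] are few;
   elsewhere closeness on the grid propagates by monotonicity. *)
Lemma monotone_grid_close (c e : R) (q : R -> R) : 0 < e ->
  {homo q : s t / s <= t} -> (forall t, 0 <= q t <= c) ->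
  exists (s : seq R) (G : set (measurableTypeR R)), [/\ measurable G,
    1 - e <= pr unif G & forall q' : R -> R, {homo q' : s t / s <= t} ->
      (forall t, t \in s -> `|q t - q' t| < e) ->
      forall t, G t -> `|q t - q' t| <= 2 * e].
Proof.
move=> e0 q_homo qc.
have c0 : 0 <= c by have /andP[/le_trans] := qc 0; exact.
(* At most [c / e] grid cells have an increment above [e], and each weighs at most [1 / M]: this [M]
   makes their total weight at most [e]. *)
pose M := (Num.bound (c / e / e)).+1.
have M0 : 0 < M%:R :> R by [].
have Me : c / (e * M%:R) <= e.
  rewrite ler_pdivrMr ?mulr_gt0// mulrA -ler_pdivrMl ?mulr_gt0//.
  rewrite invfM mulrC mulrA.
  by rewrite (le_trans (ltW (archi_boundP _)))// ?ler_nat ?divr_ge0 ?(ltW e0)//.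
pose x k : R := k%:R / M%:R.
have xS k : x k.+1 = x k + M%:R^-1 by rewrite /x -natr1 mulrDl mul1r.
pose W k : set (measurableTypeR R) := if e < q (x k.+1) - q (x k) then `[x k, x k.+1[%classic else set0.
have mW k : measurable (W k) by rewrite /W; case: ifP.
(* Markov's inequality cell by cell: on a bad cell the increment over [e] exceeds 1. These bounds
   telescope. *)
pose a k := (q (x k.+1) - q (x k)) / (e * M%:R).
have Wa k : pr unif (W k) <= a k.
  have qx : 0 <= q (x k.+1) - q (x k) by rewrite subr_ge0 q_homo// xS lerDl invr_ge0.
  rewrite /W; case: ifPn => eq; last first.
    by rewrite /pr measure0 divr_ge0// mulr_ge0// ltW.
  apply: (le_trans (unif_itvco _)); first by rewrite xS lerDl invr_ge0.
  rewrite xS addrC addKr /a invfM mulrA ler_peMl// ?invr_ge0//.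
  by rewrite ler_pdivlMr// mul1r ltW.
pose B n := \bigcup_(k in `I_n) W k.
have mB n : measurable (B n) by apply: bigcup_measurable => k _; exact: mW.
have Ba n : pr unif (B n) <= \sum_(0 <= k < n) a k.
  elim: n => [|n IHn]; first by rewrite /B II0 bigcup_set0 big_nil /pr measure0.
  rewrite big_nat_recr//= /B IIS bigcup_setU bigcup_set1.
  by apply: (le_trans (prU_le _ (mB n) (mW n))); exact: lerD.
have aE n : \sum_(0 <= k < n) a k = (q (x n) - q (x 0%N)) / (e * M%:R).
  by rewrite -mulr_suml telescope_sumr.
have m01 : measurable (`[0, 1[%classic : set (measurableTypeR R)) by [].
exists [seq x k | k <- iota 0 M.+1], (~` B M `&` `[0, 1[%classic).
split; first by apply: measurableI => //; exact: measurableC.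
  have p01 : pr unif `[0, 1[%classic = 1 :> R.
    have E : unif `[0, 1[%classic = 1%E :> \bar R.
      by rewrite unifE setIid lebesgue_measure_itv/= lte_fin ltr01 oppr0 adde0.
    exact: (congr1 fine E).
  have := prI_ge unif (measurableC (mB M)) m01; rewrite p01 addrK.
  apply: le_trans; rewrite prC// lerD2l lerN2; apply: (le_trans (Ba M)).
  rewrite aE (le_trans _ Me)// ler_pM2r ?invr_gt0 ?mulr_gt0//.
  by have /andP[? ?] := qc (x M); have /andP[? ?] := qc (x 0%N); lra.
move=> q' q'_homo qq' t [Bt]; rewrite /= in_itv/= => /andP[t0 t1].
pose k := Num.truncn (t * M%:R).
have /andP[kt tk] : k%:R <= t * M%:R < k.+1%:R.
  by rewrite truncn_itv// mulr_ge0.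
have kM : (k < M)%N.
  by rewrite -(ltr_nat R) (le_lt_trans kt)// -[ltRHS]mul1r ltr_pM2r.
have xt : x k <= t by rewrite /x ler_pdivrMr.
have tx : t < x k.+1 by rewrite /x ltr_pdivlMr.
have good : q (x k.+1) - q (x k) <= e.
  rewrite leNgt; apply/negP => bad; apply: Bt; exists k => //.
  by rewrite /W bad /= in_itv/= xt.
have in_grid j : (j <= M)%N -> x j \in [seq x k | k <- iota 0 M.+1].
  by move=> jM; apply: map_f; rewrite mem_iota.
have := qq' _ (in_grid k (ltnW kM)); have := qq' _ (in_grid k.+1 kM).
have := q_homo _ _ xt; have := q_homo _ _ (ltW tx).
have := q'_homo _ _ xt; have := q'_homo _ _ (ltW tx).
rewrite !ltr_norml ler_norml => ? ? ? ? /andP[? ?] /andP[? ?]; apply/andP; split; lra.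
Qed.

End monotone_functions.

(** * Lipschitz maps and the image spaces they define *)

Section lipschitz.
Context {R : realType}.

Lemma rv_norm_le n (v : 'rV[R]_n.+1) (e : R) : 0 <= e ->
  (forall i, `|v ord0 i| <= e) -> `|v| <= e.
Proof.
move=> e0 ve; rewrite /Num.norm/= mx_normrE; apply/bigmax_leP; split=> // -[i j] _ /=.
by rewrite (ord1 i).
Qed.

Lemma rv_coord_le n (v : 'rV[R]_n.+1) i : `|v ord0 i| <= `|v|.
Proof.
rewrite {2}/Num.norm/= mx_normrE.
exact: (le_bigmax_cond _ (fun ij : 'I_1 * 'I_n.+1 => `|v ij.1 ij.2|) (j := (ord0, i))).
Qed.

(** The extension is the infimum of [g y + mdist x y] over [y] in [A]; an empty [A], where this
    infimum is meaningless, gets the zero function. *)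
Lemma mcshane (X : metricType R) (A : set X) (g : X -> R) :
  (forall x y, A x -> A y -> g x - g y <= mdist x y) ->
  exists f : X -> R, (forall x y, `|f x - f y| <= mdist x y) /\
    (forall x, A x -> f x = g x).
Proof.
move=> gA; have [[a Aa]|A0] := pselect (A !=set0); last first.
  exists (fun=> 0); split=> [x y|x Ax]; first by rewrite subrr normr0 mdist_ge0.
  by case: A0; exists x.
pose S x := [set g y + mdist x y | y in A].
have S0 x : S x !=set0 by exists (g a + mdist x a); exists a.
have Slb x : has_lbound (S x).
  exists (g a - mdist x a) => _ [y Ay <-]; have := gA _ _ Aa Ay.
  have := metric_triangle a x y; rewrite (metric_sym a x); lra.
have fle x y : inf (S x) <= inf (S y) + mdist x y.
  rewrite -lerBlDr; apply: lb_le_inf => // _ [z Az <-]; rewrite lerBlDr.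
  apply: (@le_trans _ _ (g z + mdist x z)); first by apply: ge_inf => //; exists z.
  have := metric_triangle x y z; lra.
exists (fun x => inf (S x)); split=> [x y|x Ax].
  by rewrite ler_norml; have := fle x y; have := fle y x; rewrite (metric_sym y x) => ? ?;
    apply/andP; split; lra.
apply/eqP; rewrite eq_le; apply/andP; split.
  by apply: ge_inf => //; exists x => //; rewrite mdistxx addr0.
by apply: lb_le_inf => // _ [y Ay <-]; have := gA _ _ Ax Ay; lra.
Qed.

End lipschitz.

Section spaces.
Context {R : realType}.

Lemma lipschitz_continuous_rv (X : metricType R) n (f : X -> 'rV[R]_n.+1) :
  (forall x y, `|f x - f y| <= mdist x y) -> continuous f.
Proof.
move=> fl x A /nbhs_ballP[e e0 eA]; apply/nbhs_ballP; exists e => // y xy; apply: eA.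
by rewrite -ball_normE/=; rewrite ballEmdist/= in xy; exact: le_lt_trans (fl _ _) xy.
Qed.

Lemma lipschitz_measurable (X : completeMetricType R) (g : X -> R) :
  (forall x y, `|g x - g y| <= mdist x y) -> measurable_fun setT (g : borelType X -> R).
Proof.
move=> gl; apply: (measurability (@RGenOInfty.G R)); first exact: RGenOInfty.measurableE.
move=> _ [_ [r ->] <-]; rewrite setTI; apply: open_borel.
rewrite openE => x /=; rewrite in_itv/= andbT => rg; apply/nbhs_ballP.
exists (g x - r) => [|y]; first by rewrite /= subr_gt0.
rewrite ballEmdist/= in_itv/= andbT => xy; have := gl x y; rewrite ler_norml => /andP[_]; lra.
Qed.

Lemma const_mx_continuous n : continuous (const_mx : R -> 'rV[R]_n.+1).
Proof.
move=> x A /nbhs_ballP[e/= e0 eA]; apply/nbhs_ballP; exists e => // y xy; apply: eA.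
by split=> // i j; rewrite !mxE.
Qed.

Lemma const_mx_measurable n :
  measurable_fun setT (const_mx : measurableTypeR R -> borelType 'rV[R]_n.+1).
Proof.
apply: borel_measurable => U oU; apply: open_measurable.
by move/continuousP : (@const_mx_continuous n); exact.
Qed.

Lemma const_mx_norm n (a b : R) : `|const_mx a - const_mx b : 'rV[R]_n.+1| = `|a - b|.
Proof.
apply/eqP; rewrite eq_le; apply/andP; split.
  by apply: rv_norm_le => // i; rewrite !mxE.
by have := rv_coord_le (const_mx a - const_mx b : 'rV[R]_n.+1) ord0; rewrite !mxE.
Qed.

(** A continuous map sends the support of its source into the support of the image law, so for
    Lipschitz [f] the distances agree everywhere. A merely measurable [phi] may leave the support on
    a null set, whence [G]. *)
Lemma support_space_maps n (mu : probability (borelType 'rV[R]_n.+1) R) :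
  exists Z : mmSpace R,
  (forall phi : R -> 'rV[R]_n.+1,
     measurable_fun setT (phi : measurableTypeR R -> borelType 'rV[R]_n.+1) ->
     (forall B : set (borelType 'rV[R]_n.+1), measurable B -> unif (phi @^-1` B) = mu B) ->
     exists (phi' : R -> Z) (G : set (measurableTypeR R)), [/\ is_parameter phi', measurable G,
       pr unif G = 1 & forall s t, G s -> G t -> mdist (phi' s) (phi' t) = `|phi s - phi t|]) /\
  (forall (Y : mmSpace R) (f : Y -> 'rV[R]_n.+1), (forall y y', `|f y - f y'| <= mdist y y') ->
     (forall B : set (borelType 'rV[R]_n.+1), measurable B -> mm_measure Y (f @^-1` B) = mu B) ->
     exists p : Y -> Z, [/\ measurable_fun setT (p : borelType Y -> borelType Z),
       measure_preserving p & forall y y', mdist (p y) (p y') = `|f y - f y'|]).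
Proof.
have [Z [i [r [iE mr ZE Si iK]]]] := support_space mu.
have mS : measurable (measure_support mu : set (borelType 'rV[R]_n.+1)).
  by apply: closed_borel; exact: measure_support_closed.
have mrB (B : set (borelType Z)) : measurable B ->
    measurable (r @^-1` B : set (borelType 'rV[R]_n.+1)).
  by move=> mB; rewrite -[X in measurable X]setTI; exact: mr.
exists Z; split => [phi mphi phiE|Y f fl fE].
  exists (r \o phi), (phi @^-1` measure_support mu); split.
  - apply: is_parameter_unif; first exact: (measurableT_comp mr mphi).
    by move=> B mB; rewrite ZE// -phiE//; exact: mrB.
  - by rewrite -[X in measurable X]setTI; exact: mphi.
  - exact: (congr1 fine (etrans (phiE _ mS) (measure_support1 mu))).
  - by move=> s t Gs Gt; rewrite iE /= !iK.
have fS y : measure_support mu (f y).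
  move=> U oU Ufy; have fU := fE U (open_borel oU).
  change (0 < mu U)%E; rewrite -fU.
  have : measure_support (mm_measure Y) y by rewrite mm_support.
  apply => //; move/continuousP : (lipschitz_continuous_rv fl); exact.
have mf : measurable_fun setT (f : borelType Y -> borelType 'rV[R]_n.+1).
  exact: (continuous_borel (lipschitz_continuous_rv fl)).
exists (r \o f); split.
- exact: (measurableT_comp mr mf).
- by move=> B mB; rewrite ZE// -fE//; exact: mrB.
- by move=> y y'; rewrite iE /= !iK.
Qed.

Lemma sep_family_push (Y Z : mmSpace R) (p : Y -> Z) N (k : 'I_N.+1 -> R) (D : R)
  (A : 'I_N.+1 -> set Y) :
  measurable_fun setT (p : borelType Y -> borelType Z) -> measure_preserving p ->
  (forall i, measurable (A i : set (borelType Y))) ->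
  (forall i, ((k i)%:E <= mm_measure Y (A i))%E) ->
  (forall i j x y, i != j -> A i x -> A j y -> D <= mdist (p x) (p y)) ->
  sep_family Z k D.
Proof.
move=> mp pE mA Ak AD; pose B i : set Z := closure (p @` A i).
have mB i : measurable (B i : set (borelType Z)) by apply: closed_borel; exact: closed_closure.
exists B; split => // [i|i j x y ij]; last first.
  by apply: closure_mdist_ge => _ _ [a Aa <-] [b Ab <-]; exact: AD ij Aa Ab.
apply: (le_trans (Ak i)); rewrite -pE// le_measure ?inE//.
  by rewrite -[X in measurable X]setTI; exact: mp.
by move=> y Ay; apply: subset_closure; exists y.
Qed.

(** [Z] carries the law of a cluster point [q0] of the quantile functions, [Z'] the law of [g n].
    Both are parametrized by the same unit interval, so closeness of [q0] and [q n] bounds the box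
    distance. *)
Lemma line_cluster (Y : nat -> mmSpace R) (g : forall n, Y n -> R) (c : R) :
  (forall n y y', `|g n y - g n y'| <= mdist y y') -> (forall n y, 0 <= g n y <= c) ->
  exists Z : mmSpace R, forall (e : R) (N : nat), 0 < e -> exists2 n, (N <= n)%N &
    exists (Z' : mmSpace R) (p : Y n -> Z'), [/\
      measurable_fun setT (p : borelType (Y n) -> borelType Z'), measure_preserving p,
      (forall y y', mdist (p y) (p y') = `|g n y - g n y'|) & (box Z Z' <= e%:E)%E].
Proof.
move=> gl gc.
have qP n : exists q : R -> R, [/\ {homo q : s t / s <= t}, forall t, 0 <= q t <= c &
    forall B : set (measurableTypeR R), measurable B ->
      unif (q @^-1` B) = mm_measure (Y n) (g n @^-1` B)].
  exact: (quantile _ (lipschitz_measurable (gl n)) (gc n)).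
have [q qE] := choice qP.
have [q0 [q0_homo q0c q0_cl]] := @monotone_cluster R c q
  (fun n => let: And3 h _ _ := qE n in h) (fun n => let: And3 _ h _ := qE n in h).
have mcq (q' : R -> R) : {homo q' : s t / s <= t} -> measurable_fun setT
    (const_mx \o q' : measurableTypeR R -> borelType 'rV[R]_1).
  move=> q'_homo; apply: measurableT_comp; first exact: const_mx_measurable.
  exact: nondecreasing_measurable.
have [mu0 mu0E] := pushforward_probability (unif : probability _ R) (mcq _ q0_homo).
have [Z [Zphi _]] := support_space_maps mu0.
have [phi0 [G0 [pphi0 mG0 G01 phi0E]]] := Zphi _ (mcq _ q0_homo) (fun B mB => esym (mu0E B mB)).
exists Z => e N e0.
(* [monotone_grid_close] doubles the tolerance and a distortion involves two points, so the
   distortion is at most [e / 2]; the exceptional set weighs at most [e / 8]. *)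
have e80 : 0 < e / 8 by rewrite divr_gt0.
have [s [G [mG Ge GP]]] := monotone_grid_close e80 q0_homo q0c.
have [n Nn ns] := q0_cl (e / 8) s N e80.
exists n => //; have [qn_homo qnc qnE] := qE n.
pose f y : 'rV[R]_1 := const_mx (g n y).
have fl y y' : `|f y - f y'| <= mdist y y' by rewrite const_mx_norm.
have mf : measurable_fun setT (f : borelType (Y n) -> borelType 'rV[R]_1).
  exact: (continuous_borel (lipschitz_continuous_rv fl)).
have [mu muE] := pushforward_probability (mm_measure (Y n)) mf.
have [Z' [Z'phi Z'p]] := support_space_maps mu.
have [p [mp pE pd]] := Z'p _ f fl (fun B mB => esym (muE B mB)).
have qnmu (B : set (borelType 'rV[R]_1)) : measurable B ->
    unif ((const_mx \o q n) @^-1` B) = mu B.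
  move=> mB; rewrite muE// comp_preimage qnE//.
  by rewrite -[X in measurable X]setTI; apply: const_mx_measurable.
have [phi1 [G1 [pphi1 mG1 G11 phi1E]]] := Z'phi _ (mcq _ qn_homo) qnmu.
exists Z', p; split=> //; first by move=> y y'; rewrite pd const_mx_norm.
apply: (@box_le _ _ _ _ phi0 phi1 (G `&` (G0 `&` G1))) => //.
- exact: ltW.
- by apply: measurableI => //; exact: measurableI.
- have mGG := measurableI _ _ mG0 mG1.
  rewrite [leRHS](prE unif); last exact: measurableI.
  have := prI_ge unif mG0 mG1; have := prI_ge unif mG mGG.
  rewrite lee_fin G01 G11; lra.
- move=> a b [Ga [G0a G1a]] [Gb [G0b G1b]]; rewrite phi0E// phi1E// !const_mx_norm.
  have := GP _ qn_homo ns _ Ga; have := GP _ qn_homo ns _ Gb.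
  set x := q0 a; set y := q0 b; set x' := q n a; set y' := q n b => yy xx.
  have := ler_distD x' x y; have := ler_distD y' x' y.
  have := ler_distD x x' y'; have := ler_distD y x y'.
  rewrite (distrC x' x) (distrC y' y) => h1 h2 h3 h4.
  rewrite ler_norml; apply/andP; split; lra.
Qed.

End spaces.

(** * The four implications *)

Section simplex.
Context {R : realType}.

Lemma rv_subE n (u v : 'rV[R]_n) i : (u - v) ord0 i = u ord0 i - v ord0 i.
Proof. by rewrite !mxE. Qed.

Lemma open_norm_gt n (c : 'rV[R]_n.+1) (a : R) : open [set u | a < `|u - c|].
Proof.
rewrite openE => u uU; apply/nbhs_ballP; exists (`|u - c| - a) => [|u'].
  by rewrite /= subr_gt0.
rewrite -ball_normE/= => uu'; have := ler_distD u' u c; lra.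
Qed.

Lemma half_distance (D : R) : 0 < D -> `|D - D / 2| <= D / 2 /\ `|0 - D / 2| <= D / 2.
Proof. by move=> D0; split; rewrite ler_norml; apply/andP; split; lra. Qed.

(** In the sup norm the vectors [D e_i] are pairwise at distance exactly [D]; they carry the weights
    as atoms. *)
Lemma simplex_space N (w : 'I_N.+1 -> R) (D : R) :
  (forall i, 0 < w i) -> \sum_i w i = 1 -> 0 < D ->
  exists Z : mmSpace R, (diameter Z <= D%:E)%E /\ sep_family Z w D.
Proof.
move=> w0 w1 D0.
pose v i : 'rV[R]_N.+1 := D *: delta_mx ord0 i.
have vE i j : v i ord0 j = if j == i then D else 0.
  by rewrite !mxE eqxx /=; case: eqP => _; rewrite ?mulr1 ?mulr0.
pose m (k : nat) : {measure set (borelType 'rV[R]_N.+1) -> \bar R} :=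
  mscale (NngNum (ltW (w0 (inord k)))) (dirac (v (inord k) : borelType 'rV[R]_N.+1)).
have mE A : msum m N.+1 A = (\sum_(i < N.+1) (w i)%:E * \d_(v i : borelType 'rV[R]_N.+1) A)%E.
  by apply: eq_bigr => i _; rewrite /m /= /mscale /= inord_val.
have m1 : msum m N.+1 setT = 1%E.
  rewrite mE -[RHS]/(1%:E) -w1 -sumEFin; apply: eq_bigr => i _.
  by rewrite diracT mule1.
pose mu : probability (borelType 'rV[R]_N.+1) R :=
  HB.pack (msum m N.+1) (Measure_isProbability.Build _ _ _ _ m1).
have muE A : mu A = (\sum_(i < N.+1) (w i)%:E * \d_(v i : borelType 'rV[R]_N.+1) A)%E := mE A.
have mu_ge i A : A (v i) -> ((w i)%:E <= mu A)%E.
  move=> Av; rewrite muE (bigD1 i)//= diracE mem_set// mule1 leeDl//.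
  by apply: sume_ge0 => j _; rewrite mule_ge0// lee_fin ltW.
have [Z [iota [r [iE mr ZE Si iK]]]] := support_space mu.
have vS i : measure_support mu (v i).
  by move=> U oU Uv; rewrite (lt_le_trans _ (mu_ge i U Uv))// lte_fin.
have vK i : iota (r (v i)) = v i by rewrite iK.
exists Z; split.
  (* The atoms lie in the closed ball of radius [D / 2] about [c]. Its complement is open and null,
     so the support lies in this ball too, without having to be computed. *)
  pose c : 'rV[R]_N.+1 := const_mx (D / 2).
  have ball_iota z : `|iota z - c| <= D / 2.
    rewrite leNgt; apply/negP => Dz.
    pose U : set 'rV[R]_N.+1 := [set u | D / 2 < `|u - c|].
    have oU : open U by exact: open_norm_gt.
    have := Si z U oU Dz; rewrite -[X in (0 < X)%E]/(mu U) muE big1 ?ltxx// => i _.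
    rewrite diracE memNset ?mule0// /U /= ltNge => /negP; apply.
    apply: rv_norm_le => [|j]; first by rewrite divr_ge0// ltW.
    have [DD D0D] := half_distance D0.
    by rewrite rv_subE [c _ _]mxE vE; case: eqP.
  apply: ge_ereal_sup => _ [z _ [z' _ <-]]; rewrite lee_fin iE.
  rewrite (le_trans (ler_distD c _ _))// (splitr D) lerD// distrC; exact: ball_iota.
exists (fun i => [set r (v i)]); split.
- move=> i; apply: closed_borel; apply: accessible_closed_set1.
  exact/hausdorff_accessible/metric_hausdorff.
- move=> i; rewrite ZE; first exact: mu_ge.
  apply: closed_borel; apply: accessible_closed_set1.
  exact/hausdorff_accessible/metric_hausdorff.
- move=> i j _ _ ij -> ->; rewrite iE !vK.
  have := rv_coord_le (v i - v j) i.
  by rewrite rv_subE !vE eqxx (negbTE ij) subr0 gtr0_norm.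
Qed.

End simplex.

Section directions.
Context {R : realType}.

Lemma pos_real_below (x : \bar R) : (0 < x)%E -> exists2 c : R, 0 < c & (c%:E < x)%E.
Proof.
case: x => [x||//] x0; last by exists 1 => //; rewrite ltry.
by rewrite lte_fin in x0; exists (x / 2); rewrite ?lte_fin; lra.
Qed.

Lemma finite_lower_bound N (f : 'I_N.+1 -> R) (d : R) : 0 < d -> (forall i, 0 < f i) ->
  exists e, [/\ 0 < e, e <= d & forall i, e <= f i].
Proof.
move=> d0 f0; exists (\big[Num.min/d]_i f i); split.
- by elim/big_ind: _ => // x y x0 y0; rewrite lt_min x0.
- exact: bigmin_le_id.
- by move=> i; exact: bigmin_le_cond.
Qed.

Variables (Pn : nat -> set (mmSpace R)) (P : set (mmSpace R)).
Hypothesis PnP : weakly_converges Pn P.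

Lemma weakly_converges_sep X N (k : 'I_N.+1 -> R) (D e : R) :
  P X -> sep_family X k D -> 0 < e ->
  exists n0, forall n, (n0 <= n)%N -> exists2 Y, Pn n Y &
    sep_family Y (fun i => k i - e) (D - e).
Proof.
move=> PX XD e0; have [/(_ X PX) cvg0 _] := PnP.
have [n0 _ n0P] : \forall n \near \oo, (box_to X (Pn n) < e%:E)%E.
  by apply: (cvg0 [set x | (x < e%:E)%E]); apply: open_nbhs_nbhs; split; [exact: open_ereal_lt_ereal|rewrite /= lte_fin].
exists n0 => n /n0P /= /ereal_inf_lt[_ [Y PY <-] XY]; exists Y => //.
exact: box_sep_family XY XD.
Qed.

Lemma limn_einf_sep_ge N (k : 'I_N.+1 -> R) (D : R) n0 :
  (forall n, (n0 <= n)%N -> exists2 Y, Pn n Y & sep_family Y k D) ->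
  (D%:E <= limn_einf (fun n => pyramid_Sep (Pn n) k))%E.
Proof.
move=> n0P; apply: (@limn_einf_ge _ _ _ n0) => n /n0P[Y PY YD].
apply: pyramid_Sep_ge => eta eta0; exists Y => //; apply: sep_family_le YD => // i.
by rewrite gerBl ltW.
Qed.

Lemma dissipated_dissipates (delta : \bar R) : (0 < delta)%E ->
  dissipated delta P -> dissipates delta Pn.
Proof.
move=> delta0 Pd N k [N1 k0 k1]; apply: lee_real_lt => c cd.
have [D [D0 cD Dd]] : exists D : R, [/\ 0 < D, c < D & (D%:E <= delta)%E].
  case: delta delta0 cd {Pd} => [d||//] delta0 cd; last first.
    exists (Num.max c 0 + 1); split; last by rewrite leey.
      by rewrite ltr_wpDl// le_max lexx orbT.
    by rewrite ltr_pwDr// le_max lexx.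
  by rewrite !lte_fin in delta0 cd; exists d.
pose s := \sum_i k i.
have s0 : 0 < s.
  by rewrite /s (bigD1 ord0)//= ltr_pwDl// sumr_ge0// => i _; exact: ltW.
(* As [s < 1], normalizing raises every mass strictly; the gain pays for the mass lost to the box
   distance. *)
pose w i := k i / s.
have w1 : \sum_i w i = 1 by rewrite -mulr_suml divff// gt_eqF.
have w0 i : 0 < w i by rewrite divr_gt0.
have kw i : 0 < w i - k i.
  by rewrite subr_gt0 ltr_pdivlMr// gtr_pMr.
have [Z [dZ ZD]] := simplex_space w0 w1 D0.
have PZ : P Z by apply: Pd; exact: le_trans dZ Dd.
have [e [e0 eD ek]] := @finite_lower_bound _ _ (D - c) ltac:(by rewrite subr_gt0) kw.
have [n0 n0P] := weakly_converges_sep PZ ZD e0.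
apply: (@limn_einf_sep_ge _ _ _ n0) => n /n0P[Y PY YD]; exists Y => //.
by apply: sep_family_le YD => [i|]; [have := ek i|]; lra.
Qed.

Lemma weakly_dissipated_dissipates : weakly_dissipated P -> weakly_dissipates Pn.
Proof.
move=> Pd N k [N1 k0 k1]; pose s := \sum_i k i.
(* Half of the slack [1 - s], shared equally: the enlarged masses still sum to less than 1. One half
   of [e] pays for the [eta] in [pyramid_Sep], the other for the box distance. *)
pose e := (1 - s) / 2 / N.+1%:R.
have s1 : 0 < 1 - s by rewrite subr_gt0.
have e0 : 0 < e by rewrite !divr_gt0.
have k'P : admissible (fun i => k i + e).
  split=> // [i|]; first by rewrite addr_gt0.
  rewrite big_split/= sumr_const card_ord -[e *+ _]mulr_natr /e divfK; last by rewrite pnatr_eq0.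
  rewrite -/s; lra.
have [c c0 cP] := pos_real_below (Pd _ _ k'P).
have e20 : 0 < e / 2 by rewrite divr_gt0.
have [X PX Xc] := lt_pyramid_Sep (ltW c0) cP e20.
pose d := Num.min (e / 2) (c / 2).
have d0 : 0 < d by rewrite lt_min e20 divr_gt0.
have de : d <= e / 2 by rewrite ge_min lexx.
have dc : d <= c / 2 by rewrite ge_min lexx orbT.
have [n0 n0P] := weakly_converges_sep PX Xc d0.
apply: (@lt_le_trans _ _ (c / 2)%:E); first by rewrite lte_fin divr_gt0.
apply: (@limn_einf_sep_ge _ _ _ n0) => n /n0P[Y PY YD]; exists Y => //.
by apply: sep_family_le YD => [i|]; lra.
Qed.

End directions.

Section family_index.
Context {R : realType} (Y : mmSpace R) (N : nat) (A : 'I_N.+1 -> set Y) (D : R).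
Hypotheses (mA : forall i, measurable (A i : set (borelType Y))) (D0 : 0 < D).
Hypothesis AD : forall i j x y, i != j -> A i x -> A j y -> D <= mdist x y.

(* The junk index [N.+1] marks the points outside of the family. *)
Lemma family_index : exists k : Y -> nat, [/\
  forall i y, A i y <-> k y = i, forall y, (k y <= N.+1)%N &
  forall n, measurable (k @^-1` [set n] : set (borelType Y))].
Proof.
have A_inj i j y : A i y -> A j y -> i = j.
  move=> Ai Aj; apply/eqP/negPn/negP => ij; have := AD ij Ai Aj.
  by rewrite mdistxx leNgt D0.
pose k y : nat := if [pick i | `[< A i y >]] is Some i then i else N.+1.
have kA i y : A i y <-> k y = i.
  rewrite /k; case: pickP => [j /asboolP Aj|Ai]; split.
  - by move=> Ai; rewrite (A_inj _ _ _ Aj Ai).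
  - by move=> /ord_inj <-.
  - by move=> Aiy; have /asboolP := Ai i.
  - by move=> Ni; have := ltn_ord i; rewrite -Ni ltnn.
have kN y : (k y <= N.+1)%N by rewrite /k; case: pickP => [j _|_]; rewrite ?leqnn// ltnW.
exists k; split => // n.
have mk m : (m < N.+1)%N -> measurable (k @^-1` [set m] : set (borelType Y)).
  move=> mN; rewrite (_ : _ @^-1` _ = A (Ordinal mN))//.
  by apply/seteqP; split => y /=; [move=> ky; exact/kA|move/kA].
have [/mk//|Nn] := ltnP n N.+1.
rewrite (_ : _ @^-1` _ = if n == N.+1 then ~` \bigcup_(m in `I_N.+1) k @^-1` [set m] else set0).
  case: eqP => // _; apply: measurableC; apply: bigcup_measurable => m; exact: mk.
apply/seteqP; split => y /=; case: eqP => [->|nN].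
- by move=> ky [m /= mN km]; rewrite -km ky ltnn in mN.
- by move=> ky; apply: nN; apply/eqP; rewrite eqn_leq Nn -ky kN.
- move=> ky; apply/eqP; rewrite eqn_leq kN leqNgt; apply/negP => yN.
  by apply: ky; exists (k y).
- by [].
Qed.

End family_index.

Section clip.
Context {R : realType}.

Lemma clip_lipschitz (c a b : R) :
  `|Num.min (Num.max a 0) c - Num.min (Num.max b 0) c| <= `|a - b|.
Proof.
have minl (x y : R) : `|Num.min x c - Num.min y c| <= `|x - y|.
  have := ler_norm (x - y); have := ler_norm (y - x); rewrite (distrC y x) => h1 h2.
  by rewrite ler_norml; case: (leP x c) => ?; case: (leP y c) => ?; apply/andP; split; lra.
apply: le_trans (minl _ _) _.
have := ler_norm (a - b); have := ler_norm (b - a); rewrite (distrC b a) => h1 h2.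
by rewrite ler_norml; case: (leP a 0) => ?; case: (leP b 0) => ?; apply/andP; split; lra.
Qed.

Lemma natr_dist_ge1 (i j : nat) : i != j -> 1 <= `|i%:R - j%:R : R|.
Proof.
rewrite ler_normr; case: ltngtP => // ij _; apply/orP; [right|left].
  have : i.+1%:R <= j%:R :> R by rewrite ler_nat.
  by rewrite -natr1; lra.
have : j.+1%:R <= i%:R :> R by rewrite ler_nat.
by rewrite -natr1; lra.
Qed.

End clip.

Section weak_direction.
Context {R : realType}.
Variables (Pn : nat -> set (mmSpace R)) (P : set (mmSpace R)).
Hypotheses (pyrPn : forall n, pyramid (Pn n)).
Hypothesis PnP : weakly_converges Pn P.

(** If [X] were not in [P], the positive lower limit would keep it away from all late [Pn n]. *)
Lemma weakly_converges_frequently X :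
  (forall (e : R) n0, 0 < e -> exists2 n, (n0 <= n)%N & exists2 Y, Pn n Y & (box X Y <= e%:E)%E) ->
  P X.
Proof.
move=> XP; apply: contrapT => /(PnP.2 X) /pos_real_below[e e0 /lt_limn_einf[n0 n0P]].
have [n n0n [Y PY XY]] := XP e n0 e0.
have := n0P n n0n; rewrite ltNge => /negP; apply; apply: le_trans XY.
by apply: ereal_inf_lbound; exists Y.
Qed.

Lemma dominated_isometric n (Y Z : mmSpace R) (p : Y -> Z) : Pn n Y ->
  (forall y y', mdist (p y) (p y') <= mdist y y') -> measure_preserving p -> Pn n Z.
Proof. by move=> PY pl pE; apply: (pyramid_lower (pyrPn n) PY); exists p. Qed.

Lemma weakly_dissipates_dissipated : weakly_dissipates Pn -> weakly_dissipated P.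
Proof.
move=> Pd N k kP; have [N1 k0 k1] := kP.
have [c c0 /lt_limn_einf[n0 n0P]] := pos_real_below (Pd _ _ kP).
(* Any two members of the family are only known to be [c] apart, so all the values [i h] must fit in
   a span of [c] to be 1-Lipschitz data. *)
pose h := c / N.+1%:R; have h0 : 0 < h by rewrite divr_gt0.
apply: (@lt_le_trans _ _ (h / 2)%:E); first by rewrite lte_fin divr_gt0.
apply: pyramid_Sep_ge => eta eta0.
have eta20 : 0 < eta / 2 by rewrite divr_gt0.
pose good (Y : mmSpace R) (g : Y -> R) := [/\
    forall y y', `|g y - g y'| <= mdist y y', forall y, 0 <= g y <= c &
    exists A : 'I_N.+1 -> set Y, [/\ forall i, measurable (A i : set (borelType Y)),
      forall i, ((k i - eta / 2)%:E <= mm_measure Y (A i))%E &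
      forall i j x y, i != j -> A i x -> A j y -> h <= `|g x - g y|]].
have YP n : exists Y : mmSpace R, Pn (n0 + n)%N Y /\ exists g : Y -> R, good Y g.
  have [Y PY [A [mA Ak AD]]] := lt_pyramid_Sep (ltW c0) (n0P _ (leq_addr n n0)) eta20.
  have [idx [idxA idxN _]] := family_index mA c0 AD.
  have idxP y i : A i y -> idx y = i by move/idxA.
  have hc (i j : 'I_N.+1) : i%:R * h - j%:R * h <= c.
    rewrite -mulrBl /h mulrA ler_pdivrMr// mulrC ler_pM2l//.
    have : i%:R <= N.+1%:R :> R by rewrite ler_nat ltnW.
    have : 0 <= j%:R :> R by [].
    by lra.
  have [f [fl fE]] := @mcshane _ Y (\bigcup_i A i) (fun y => (idx y)%:R * h)
    (fun x y => fun '(ex_intro2 i _ Ai) '(ex_intro2 j _ Aj) =>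
       ltac:(rewrite (idxP _ _ Ai) (idxP _ _ Aj); have [<-|ij] := eqVneq i j;
         [by rewrite subrr mdist_ge0|exact: le_trans (hc i j) (AD _ _ _ _ ij Ai Aj)])).
  (* The McShane extension may leave [0, c]; clipping confines it to the common compact interval and
     keeps the prescribed values. *)
  exists Y; split=> //; exists (fun y => Num.min (Num.max (f y) 0) c); split.
  - by move=> y y'; apply: le_trans (fl y y'); exact: clip_lipschitz.
  - move=> y; apply/andP; split; last by rewrite ge_min lexx orbT.
    by rewrite le_min le_max lexx orbT ltW.
  - exists A; split => // i j x y ij Ax Ay.
    have clipE (l : 'I_N.+1) z : A l z -> Num.min (Num.max (f z) 0) c = l%:R * h.
      move=> Az; rewrite fE; last by exists l.
      rewrite (idxP _ _ Az) max_l; last by rewrite mulr_ge0// ltW.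
      by rewrite min_l//; have := hc l ord0; rewrite mul0r subr0.
    rewrite (clipE _ _ Ax) (clipE _ _ Ay) -mulrBl normrM (gtr0_norm h0).
    by apply: ler_peMl; [exact: ltW|exact: natr_dist_ge1].
have [Y [PY [g gE]]] : exists Y : nat -> mmSpace R, (forall n, Pn (n0 + n)%N (Y n)) /\
    exists g : forall n, Y n -> R, forall n, good (Y n) (g n).
  have [Y YE] := choice YP; exists Y; split => [n|]; first exact: (YE n).1.
  by exists (fun n => projT1 (cid (YE n).2)) => n; exact: projT2 (cid (YE n).2).
have gl n y y' : `|g n y - g n y'| <= mdist y y' by have [] := gE n.
have gc n y : 0 <= g n y <= c by have [] := gE n.
have [Z ZP] := line_cluster gl gc.
exists Z.
  apply: weakly_converges_frequently => e n1 e0.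
  have [n n1n [Z' [p [mp pE pd ZZ']]]] := ZP e n1 e0.
  exists (n0 + n)%N; first by rewrite (leq_trans n1n)// leq_addl.
  exists Z' => //; apply: dominated_isometric (PY n) _ pE => y y'.
  by rewrite pd.
(* The strict bound on the box distance is [2 * e]: together with the [eta / 2] already spent the
   mass loss is at most [eta], and a separation [h / 2] remains. *)
pose e := Num.min (eta / 4) (h / 4).
have e0 : 0 < e by rewrite lt_min !divr_gt0.
have e_eta : e <= eta / 4 by rewrite ge_min lexx.
have e_h : e <= h / 4 by rewrite ge_min lexx orbT.
have [n _ [Z' [p [mp pE pd ZZ']]]] := ZP e 0%N e0.
have [_ _ [A [mA Ak AD]]] := gE n.
have Z'h : sep_family Z' (fun i => k i - eta / 2) h.
  by apply: (sep_family_push mp pE mA Ak) => i j x y ij Ax Ay; rewrite pd; exact: AD ij Ax Ay.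
have Z'Z : (box Z' Z < (2 * e)%:E)%E.
  by rewrite box_sym (le_lt_trans ZZ')// lte_fin; lra.
by apply: sep_family_le (box_sep_family Z'Z Z'h) => [i|]; lra.
Qed.

End weak_direction.

(** * Finite cell decompositions and their copies in separated spaces *)

Section index_mass.
Context {R : realType}.

Lemma pr_preimageS d (T : measurableType d) (P : probability T R) (k : T -> nat)
    (J : set nat) (m : nat) : (forall n, measurable (k @^-1` [set n])) ->
  pr P (k @^-1` (J `&` `I_m.+1)) =
    (if `[< J m >] then pr P (k @^-1` [set m]) else 0) + pr P (k @^-1` (J `&` `I_m)).
Proof.
move=> mk; have mJ J' := nat_preimage_measurable J' mk.
rewrite (prDI P (mJ _) (mJ `I_m)); congr (_ + _).
  case: asboolP => Jm.
    congr (pr P _); apply/seteqP; split => x /=; last by move=> ->; rewrite ltnn; split.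
    by move=> [[_ km] mk']; apply/eqP; rewrite eqn_leq; apply/andP; split; [exact: km|rewrite leqNgt; exact/negP].
  rewrite (_ : _ `\` _ = set0); first by rewrite /pr measure0.
  apply/seteqP; split => // x /= [[Jk km] mk']; apply: Jm; rewrite (_ : m = k x)//.
  by apply/eqP; rewrite eqn_leq; apply/andP; split; [rewrite leqNgt; exact/negP|exact: km].
congr (pr P _); apply/seteqP; split => x /= [].
  by move=> [].
by move=> Jk km; split=> //; split=> //; exact: ltnW.
Qed.

Lemma pr_preimage_I d (T : measurableType d) (P : probability T R) (k : T -> nat)
    (m : nat) : (forall n, measurable (k @^-1` [set n])) ->
  pr P (k @^-1` `I_m) = \sum_(i < m) pr P (k @^-1` [set nat_of_ord i]).
Proof.
move=> mk; elim: m => [|m IHm].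
  by rewrite II0 preimage_set0 big_ord0 /pr measure0.
rewrite big_ord_recr/= -IHm addrC -(setTI `I_m.+1) pr_preimageS// setTI.
by case: asboolP => // -[].
Qed.

(** Each of the [M + 1] possible values of [k] loses at most [s]. One-sided bounds suffice, since
    upper bounds follow by passing to complements. *)
Lemma pr_index_le d (T : measurableType d) (P : probability T R) (k : T -> nat)
    d' (T' : measurableType d') (P' : probability T' R) (k' : T' -> nat) (M : nat) (s : R) :
  (forall n, measurable (k @^-1` [set n])) -> (forall n, measurable (k' @^-1` [set n])) ->
  (forall x, (k x <= M)%N) -> 0 <= s ->
  (forall n, (n <= M)%N -> pr P (k @^-1` [set n]) - s <= pr P' (k' @^-1` [set n])) ->
  forall J : set nat, pr P (k @^-1` J) - M.+1%:R * s <= pr P' (k' @^-1` J).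
Proof.
move=> mk mk' kM s0 kk' J.
have step m : (m <= M.+1)%N ->
    pr P (k @^-1` (J `&` `I_m)) - m%:R * s <= pr P' (k' @^-1` (J `&` `I_m)).
  elim: m => [|m IHm] mM; first by rewrite II0 setI0 !preimage_set0 /pr !measure0 mul0r subr0.
  rewrite !pr_preimageS// -natr1; have := IHm (ltnW mM); have := kk' m mM.
  by case: asboolP => _; lra.
have -> : k @^-1` J = k @^-1` (J `&` `I_M.+1).
  by apply/seteqP; split => [x Jx|x []//]; split=> //=; rewrite ltnS.
apply: le_trans (step _ (leqnn _)) _; apply: pr_le; try exact: nat_preimage_measurable.
by move=> x [].
Qed.

End index_mass.

Section cells.
Context {R : realType}.

(** By continuity from below, finitely many [e]-balls around a dense sequence carry almost all the
    mass. Outside them [k] takes a default value, so the distance bound holds only on [E]. *)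
Lemma finite_cells (X : mmSpace R) (e : R) : 0 < e ->
  exists (xs : nat -> X) (M : nat) (k : X -> nat) (E : set (borelType X)), [/\
    (forall n, measurable (k @^-1` [set n] : set (borelType X))) /\ measurable E,
    (0 < M)%N, forall x, (k x <= M)%N, 1 - e <= pr (mm_measure X) E &
    forall x, E x -> mdist (xs (k x)) x < e].
Proof.
move=> e0; have [xs xs_near] := dense_sequence X.
pose E n : set (borelType X) := \bigcup_(i in `I_n) ball (xs i) e.
have mball i : measurable (ball (xs i) e : set (borelType X)).
  by apply: open_borel; exact: ball_metric_open.
have mE n : measurable (E n) by apply: bigcup_measurable.
have E_cvg : (mm_measure X \o E) @ \oo --> mm_measure X (\bigcup_n E n).
  apply: nondecreasing_cvg_mu => //; first exact: bigcup_measurable.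
  move=> n m nm; apply/subsetPset => x [i /= ni xi]; exists i => //=.
  exact: leq_trans ni nm.
have ET : \bigcup_n E n = setT.
  apply/seteqP; split => // x _; have [n xn] := xs_near x e e0.
  by exists n.+1 => //; exists n => //=; rewrite ballEmdist.
rewrite ET probability_setT in E_cvg.
(* [M] is made positive because the cells will index a choice of masses, and [admissible] asks for
   at least two. *)
have [M M0 EM] : exists2 M, (0 < M)%N & 1 - e <= pr (mm_measure X) (E M.+1).
  have : \forall n \near \oo, ((1 - e)%:E < mm_measure X (E n))%E.
    apply: (E_cvg [set y | ((1 - e)%:E < y)%E]); apply: open_nbhs_nbhs; split.
      exact: open_ereal_gt_ereal.
    by rewrite /= lte_fin; lra.
  move=> [n _ nP]; exists n.+1 => //.
  have /= := nP n.+2 ltac:(by rewrite /= ltnW// ltnW).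
  by rewrite prE// lte_fin => /ltW.
pose b x n := (n <= M)%N && (mdist (xs n) x < e).
have mb n : measurable ([set x | b x n] : set (borelType X)).
  rewrite /b; case: (n <= M)%N => /=; last by rewrite (_ : [set _ | _] = set0)//; apply/seteqP; split.
  by have := mball n; rewrite ballEmdist.
exists xs, M, (first_bit \o b), (E M.+1); split=> //.
- by split=> // n; exact: first_bit_measurable.
- move=> x /=; have [[n bn]|nb] := pselect (exists n, b x n).
    by have /andP[] := first_bitP bn.
  by rewrite /first_bit; case: pselect.
- move=> x [n /= nM xn]; rewrite ballEmdist/= in xn.
  have bn : b x n by rewrite /b -ltnS nM.
  by have /andP[] := first_bitP bn.
Qed.

End cells.

Section truncated_metric.
Context {R : realType} (X : metricType R) (D : R).

Definition tdist (x y : X) := Num.min (mdist x y) D.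

Lemma tdist_sub (x y z : X) : 0 <= D -> tdist x z - tdist y z <= tdist x y.
Proof.
move=> D0; rewrite /tdist.
have := metric_triangle x y z; have := mdist_ge0 x y; have := mdist_ge0 y z.
by case: (leP (mdist x z) D) => ?; case: (leP (mdist y z) D) => ?;
  case: (leP (mdist x y) D) => ?; lra.
Qed.

End truncated_metric.

(** Strictness of [D < delta] is what yields actual families from a lower limit that is only at
    least [delta]. For infinite [delta], [D] exceeds all the distances in question and truncates
    nothing. *)
Lemma truncation_level {R : realType} (X : mmSpace R) (delta : \bar R) (e : R)
    (xs : nat -> X) (M : nat) : (0 < delta)%E -> (diameter X <= delta)%E -> 0 < e ->
  exists D : R, [/\ 0 < D, (D%:E < delta)%E &
    forall i j, (i <= M)%N -> (j <= M)%N -> mdist (xs i) (xs j) <= D + e].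
Proof.
move=> delta0 Xdelta e0; case: delta delta0 Xdelta => [d||//] delta0 Xd.
  rewrite lte_fin in delta0; exists (Num.max (d - e) (d / 2)); split.
  - by rewrite lt_max divr_gt0 ?orbT.
  - by rewrite lte_fin gt_max; apply/andP; split; lra.
  - move=> i j _ _; have : mdist (xs i) (xs j) <= d.
      rewrite -lee_fin (le_trans _ Xd)//; apply: ereal_sup_ubound.
      by exists (xs i) => //; exists (xs j).
    have : d - e <= Num.max (d - e) (d / 2) by rewrite le_max lexx.
    lra.
pose S := \sum_(p : 'I_M.+1 * 'I_M.+1) mdist (xs p.1) (xs p.2).
have S0 : 0 <= S by apply: sumr_ge0 => p _; exact: mdist_ge0.
exists (S + 1); split; [by rewrite ltr_wpDl| by rewrite ltry|].
move=> i j iM jM; have : mdist (xs i) (xs j) <= S.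
  rewrite /S (bigD1 (Ordinal (iM : (i < M.+1)%N), Ordinal (jM : (j < M.+1)%N)))//= lerDl.
  by apply: sumr_ge0 => p _; exact: mdist_ge0.
by lra.
Qed.

Section strong_direction.
Context {R : realType}.

Let mass_bound (g p i m e : R) : 1 - m <= g -> 1 - e <= p -> m <= e ->
  g + p - 1 <= i -> 0 < e -> ((1 - 3 * e)%:E <= i%:E)%E.
Proof. by move=> *; rewrite lee_fin; lra. Qed.

(* [Z] is the image of [Y] under the McShane extensions of the distances to the
   points [xs j]; truncating them at [D] makes them 1-Lipschitz on the separated
   family [B], where they are prescribed. *)
Lemma separated_approximation (X Y : mmSpace R) (xs : nat -> X) (M : nat) (k : X -> nat)
    (E : set (borelType X)) (B : 'I_M.+1 -> set Y) (D e s : R) :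
  (forall n, measurable (k @^-1` [set n] : set (borelType X))) -> measurable E ->
  (forall x, (k x <= M)%N) -> 1 - e <= pr (mm_measure X) E ->
  (forall x, E x -> mdist (xs (k x)) x < e) ->
  0 < D -> 0 < e -> 0 <= s -> M.+1%:R * (M.+1%:R * s) <= e ->
  (forall i j, (i <= M)%N -> (j <= M)%N -> mdist (xs i) (xs j) <= D + e) ->
  (forall i, measurable (B i : set (borelType Y))) ->
  (forall i : 'I_M.+1, ((pr (mm_measure X) (k @^-1` [set nat_of_ord i]) - s)%:E <= mm_measure Y (B i))%E) ->
  (forall i j x y, i != j -> B i x -> B j y -> D <= mdist x y) ->
  exists Z : mmSpace R, dominated Z Y /\ (box X Z <= (3 * e)%:E)%E.
Proof.
move=> mk mE kM Ee Ek D0 e0 s0 se xsD mB Bk BD.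
have [kY [kYB kYM mkY]] := family_index mB D0 BD.
have kYB' (i : 'I_M.+1) : kY @^-1` [set nat_of_ord i] = B i.
  by apply/seteqP; split => y /=; [move=> ky; apply/kYB|move/kYB].
have kkY n : (n <= M)%N ->
    pr (mm_measure X) (k @^-1` [set n]) - s <= pr (mm_measure Y) (kY @^-1` [set n]).
  by move=> nM; have := Bk (Ordinal (nM : (n < M.+1)%N)); rewrite -kYB' prE// lee_fin.
have mass := pr_index_le mk mkY kM s0 kkY.
have massI i : `|pr (mm_measure X) [set x | (k x <= i)%N] -
                 pr (mm_measure Y) [set y | (kY y <= i)%N]| <= M.+1%:R * s.
  have mX := nat_preimage_measurable [set n | (n <= i)%N] mk.
  have mY := nat_preimage_measurable [set n | (n <= i)%N] mkY.
  have := mass [set n | (n <= i)%N]; have := mass (~` [set n | (n <= i)%N]).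
  rewrite !preimage_setC (prC _ mX) (prC _ mY) => h1 h2.
  change (`|pr (mm_measure X) (k @^-1` [set n | (n <= i)%N]) -
            pr (mm_measure Y) (kY @^-1` [set n | (n <= i)%N])| <= M.+1%:R * s).
  rewrite ler_norml; apply/andP; split; lra.
(* The bound is [M.+1] because [kY] also takes the junk value [M.+1]. One factor [M.+1] in the
   hypothesis on [s] comes from summing over cells, the other from aligning that many sublevel
   sets. *)
have [phi [psi [G [[mphi phiE] [mpsi psiE] mG Ge Gk]]]] := @matched_parameters R X Y k kY M.+1 _
  (mulr_ge0 (ler0n _ _) s0) mk mkY (fun x => leqW (kM x)) kYM (fun i _ => massI i).
have tE (i j l : nat) : tdist D (xs i) (xs l) - tdist D (xs j) (xs l) <= tdist D (xs i) (xs j).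
  by apply: tdist_sub; exact: ltW.
have fP (l : 'I_M.+1) : exists f : Y -> R, (forall y y', `|f y - f y'| <= mdist y y') /\
    (forall y, (\bigcup_i B i) y -> f y = tdist D (xs (kY y)) (xs l)).
  apply: mcshane => y y' [i _ Bi] [j _ Bj].
  rewrite ((kYB i y).1 Bi) ((kYB j y').1 Bj); have [<-|ij] := eqVneq i j.
    by rewrite subrr mdist_ge0.
  by rewrite (le_trans (tE _ _ _))// (le_trans _ (BD _ _ _ _ ij Bi Bj))// ge_min lexx orbT.
have [f fE] := choice fP.
pose F y : 'rV[R]_M.+1 := \row_l f l y.
have Fl y y' : `|F y - F y'| <= mdist y y'.
  apply: rv_norm_le => [|l]; first exact: mdist_ge0.
  by rewrite rv_subE !mxE; exact: (fE l).1.
have mF : measurable_fun setT (F : borelType Y -> borelType 'rV[R]_M.+1).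
  exact: (continuous_borel (lipschitz_continuous_rv Fl)).
have [mu muE] := pushforward_probability (mm_measure Y) mF.
have [Z [_ Zp]] := support_space_maps mu.
have [p [mp pE pd]] := Zp Y F Fl (fun B mB => esym (muE B mB)).
exists Z; split; first by exists p; split=> // y y'; rewrite pd.
have mphiE : measurable (phi @^-1` E : set (measurableTypeR R)).
  by rewrite -[X in measurable X]setTI; exact: mphi.
(* Kuratowski's embedding for the truncated metric: the triangle inequality bounds every coordinate,
   and the coordinate of the second point attains the bound. *)
have Fdist y y' : (\bigcup_i B i) y -> (\bigcup_i B i) y' ->
    `|F y - F y'| = tdist D (xs (kY y)) (xs (kY y')).
  move=> By By'; apply/eqP; rewrite eq_le; apply/andP; split.
    apply: rv_norm_le => [|l]; first by rewrite /tdist le_min mdist_ge0 ltW.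
    rewrite rv_subE !mxE (fE l).2// (fE l).2// ler_norml tE andbT lerNl opprB.
    by rewrite {3}/tdist metric_sym; exact: tE.
  case: (By') => j _ Bj; have kj := (kYB j y').1 Bj.
  have := rv_coord_le (F y - F y') j; rewrite rv_subE !mxE (fE j).2// (fE j).2// kj.
  have -> : tdist D (xs j) (xs j) = 0 by rewrite /tdist mdistxx min_l// ltW.
  rewrite subr0; apply: le_trans.
  exact: ler_norm.
(* Replacing two points by their cell centres costs [2 * e], truncation costs another [e]. The
   discarded mass is at most [2 * e]: misalignment and the complement of [E]. *)
apply: (@box_le _ _ _ _ phi (p \o psi) (G `&` phi @^-1` E)).
- by rewrite mulr_ge0// ltW.
- exact: is_parameter_unif.
- apply: is_parameter_unif; first exact: (measurableT_comp mp mpsi).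
  move=> C mC; rewrite comp_preimage psiE ?pE//.
  by rewrite -[X in measurable X]setTI; exact: mp.
- exact: measurableI.
- rewrite [leRHS](prE unif); last exact: measurableI.
  have phiEe : pr unif (phi @^-1` E) = pr (mm_measure X) E := congr1 fine (phiE _ mE).
  have GE := prI_ge unif mG mphiE; rewrite phiEe in GE.
  exact: mass_bound Ge Ee se GE e0.
- move=> a b [Ga Ea] [Gb Eb].
  (* The index of [phi t] is at most [M], so the equal index of [psi t] is not the junk one. *)
  have inB t : G t -> (\bigcup_i B i) (psi t).
    move=> Gt; have kt := kM (phi t).
    by exists (Ordinal (kt : (k (phi t) < M.+1)%N)) => //; apply/kYB; rewrite -Gk.
  rewrite /= pd Fdist; [|exact: inB..]; rewrite -!Gk//.
  have := Ek _ Ea; have := Ek _ Eb; have := xsD _ _ (kM (phi a)) (kM (phi b)).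
  set x := xs (k (phi a)); set y := xs (k (phi b)) => xyD yb xa.
  have h1 := metric_triangle (phi a) x (phi b); have h2 := metric_triangle x y (phi b).
  have h3 := metric_triangle x (phi a) y; have h4 := metric_triangle (phi a) (phi b) y.
  rewrite (metric_sym (phi a) x) in h1; rewrite (metric_sym (phi b) y) in h4.
  have t1 : tdist D x y <= mdist x y by rewrite ge_min lexx.
  have t2 : mdist x y - e <= tdist D x y by rewrite le_min; apply/andP; split; lra.
  rewrite ler_norml; apply/andP; split; lra.
Qed.

Variables (Pn : nat -> set (mmSpace R)) (P : set (mmSpace R)).
Hypotheses (pyrPn : forall n, pyramid (Pn n)).
Hypothesis PnP : weakly_converges Pn P.

Lemma dissipates_dissipated (delta : \bar R) : (0 < delta)%E ->
  dissipates delta Pn -> dissipated delta P.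
Proof.
move=> delta0 Pd X Xdelta; apply: (weakly_converges_frequently PnP) => e0 n0 e00.
pose e := e0 / 3; have e_gt0 : 0 < e by rewrite divr_gt0.
have [xs [M [k [E [[mk mE] M0 kM Ee Ek]]]]] := finite_cells X e_gt0.
have [D [D0 Ddelta xsD]] := truncation_level xs M delta0 Xdelta e_gt0.
pose m : R := M.+1%:R; have m0 : 0 < m by rewrite ltr0n.
pose t := Num.min (1 / 2) (e / (3 * m * m)).
have t0 : 0 < t by rewrite lt_min divr_gt0//= divr_gt0// !mulr_gt0.
have t12 : t <= 1 / 2 by rewrite ge_min lexx.
have te : t <= e / (3 * m * m) by rewrite ge_min lexx orbT.
pose a (i : 'I_M.+1) := pr (mm_measure X) (k @^-1` [set nat_of_ord i]).
have a0 i : 0 <= a i by exact: pr_ge0.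
have a1 : \sum_i a i = 1.
  rewrite -(pr_preimage_I _ M.+1 mk) (_ : _ @^-1` _ = setT) ?prT//.
  by apply/seteqP; split => // x _ /=; rewrite ltnS.
have aM i : a i <= 1 by apply: pr_le1.
(* The term [t / m] makes the masses positive even for null cells, and the factor [1 - 2 * t] brings
   their sum down to [1 - t]. After a further loss [t] in [lt_pyramid_Sep], at least [a i - 3 * t]
   is left; the second bound on [t] makes [m * (m * (3 * t))] at most [e]. *)
pose kappa i := (1 - 2 * t) * a i + t / m.
have kappaP : admissible kappa.
  split => // [i|].
    by rewrite ltr_wpDl ?divr_gt0// mulr_ge0//; lra.
  rewrite big_split/= -mulr_sumr a1 sumr_const card_ord -[(t / m) *+ _]mulr_natr divfK ?gt_eqF//.
  by lra.
have [n1 n1P] := lt_limn_einf (lt_le_trans Ddelta (Pd _ _ kappaP)).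
pose n := maxn n0 n1.
have [Y PY [B [mB Bk BD]]] := lt_pyramid_Sep (ltW D0) (n1P n (leq_maxr _ _)) t0.
have Bs (i : 'I_M.+1) : ((a i - 3 * t)%:E <= mm_measure Y (B i))%E.
  apply: le_trans (Bk i); rewrite lee_fin /kappa.
  have ta : 2 * t * a i <= 2 * t by rewrite ler_piMr// mulr_ge0// ltW.
  have : 0 < t / m by rewrite divr_gt0.
  move: ta; rewrite -/(a i) mulrBl mul1r; set u := 2 * t * a i; set v := t / m.
  clearbody u v; clear -t0; lra.
have se : m * (m * (3 * t)) <= e.
  rewrite (_ : m * _ = t * (3 * m * m)) -?ler_pdivlMr ?mulr_gt0//.
  by rewrite [RHS]mulrC !mulrA -[3 * m * m]mulrA [3 * (m * m)]mulrC.
have [Z [ZY XZ]] := separated_approximation mk mE kM Ee Ek D0 e_gt0 (mulr_ge0 (ler0n _ 3) (ltW t0)) se xsD mB Bs BD.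
exists n; first exact: leq_maxl.
exists Z; first exact: (pyramid_lower (pyrPn n) PY).
by rewrite (le_trans XZ)// lee_fin /e mulrC divfK.
Qed.

End strong_direction.

Theorem lemma6p3 (R : realType) (Pn : nat -> set (mmSpace R))
    (P : set (mmSpace R)) :
  (forall n, pyramid (Pn n)) -> pyramid P -> weakly_converges Pn P ->
  (forall delta : \bar R, (0%E < delta)%E ->
     (dissipates delta Pn <-> dissipated delta P)) /\
  (weakly_dissipates Pn <-> weakly_dissipated P).
Proof.
move=> pyrPn pyrP PnP; split=> [delta delta0|]; split.
- exact: dissipates_dissipated.
- exact: dissipated_dissipates.
- exact: weakly_dissipates_dissipated.
- exact: weakly_dissipated_dissipates.
Qed.
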